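(* Let $f\in{\cal N}_1$ have divisor $D=((a_n),(b_n))$ and let $\delta>0$. Then there are constants $C_\delta,C'_\delta<\infty$ such that $|f(z)|\le C_\delta$ for all $z\notin\bigcup_nB(b_n,\delta)$, $|f(z)|\ge1/C_\delta$ for all $z\notin\bigcup_nB(a_n,\delta)$, and $|f'(z)/f(z)|\le C'_\delta$ for all $z\notin\bigcup_nB(a_n,\delta)\cup\bigcup_nB(b_n,\delta)$.
   Context: $\rho_S$ is the spherical metric. A meromorphic $f$ on $\mathbb{C}$ is normal if every sequence of translates $f(z+h_n)$ has a subsequence Cauchy in $\rho_S$ uniformly on compacta; $f\in{\cal N}_1$ if moreover no such limit of translates is a constant function (including $\infty$). The divisor lists zeros $a_n$ and poles $b_n$ of $f$ with multiplicity. *)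

(* Defs.v *)
From Stdlib Require Import Reals Lra.
Open Scope R_scope.

Definition Cx : Type := (R * R)%type.
Definition Cadd (z w : Cx) : Cx := (fst z + fst w, snd z + snd w).
Definition Csub (z w : Cx) : Cx := (fst z - fst w, snd z - snd w).
Definition Cmul (z w : Cx) : Cx :=
  (fst z * fst w - snd z * snd w, fst z * snd w + snd z * fst w).
Definition Cnorm2 (z : Cx) : R := fst z * fst z + snd z * snd z.
Definition Cnorm (z : Cx) : R := sqrt (Cnorm2 z).
Definition C0 : Cx := (0, 0).
Definition Cinv (z : Cx) : Cx := (fst z / Cnorm2 z, - snd z / Cnorm2 z).
Definition Cdiv (z w : Cx) : Cx := Cmul z (Cinv w).

(* Riemann sphere: None is the point at infinity. *)
Definition Chat : Type := option Cx.

(* Chordal (spherical) metric on the Riemann sphere. *)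
Definition rhoS (u v : Chat) : R :=
  match u, v with
  | Some z, Some w =>
      2 * Cnorm (Csub z w) / sqrt ((1 + Cnorm2 z) * (1 + Cnorm2 w))
  | Some z, None | None, Some z => 2 / sqrt (1 + Cnorm2 z)
  | None, None => 0
  end.

Definition has_cderiv (f : Cx -> Chat) (z0 d : Cx) : Prop :=
  exists w0, f z0 = Some w0 /\
  forall eps, 0 < eps -> exists del, 0 < del /\
    forall z, 0 < Cnorm (Csub z z0) < del ->
      exists w, f z = Some w /\
        Cnorm (Csub (Csub w w0) (Cmul d (Csub z z0))) <= eps * Cnorm (Csub z z0).

Definition recip (f : Cx -> Chat) (z : Cx) : Chat :=
  match f z with
  | None => Some C0
  | Some w => if Req_EM_T (Cnorm2 w) 0 then None else Some (Cinv w)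
  end.

Definition meromorphic (f : Cx -> Chat) : Prop :=
  forall z0,
    (exists d, has_cderiv f z0 d) \/
    (f z0 = None /\ (exists d, has_cderiv (recip f) z0 d) /\
     exists r, 0 < r /\ forall z, 0 < Cnorm (Csub z z0) < r -> f z <> None).

Definition translate (f : Cx -> Chat) (h : Cx) : Cx -> Chat := fun z => f (Cadd z h).

Definition strictly_increasing (phi : nat -> nat) : Prop :=
  forall n, (phi n < phi (S n))%nat.

Definition loc_unif_cauchy (g : nat -> Cx -> Chat) : Prop :=
  forall Rad eps, 0 < eps -> exists N, forall m n, (N <= m)%nat -> (N <= n)%nat ->
    forall z, Cnorm z <= Rad -> rhoS (g m z) (g n z) < eps.

Definition loc_unif_conv (g : nat -> Cx -> Chat) (lim : Cx -> Chat) : Prop :=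
  forall Rad eps, 0 < eps -> exists N, forall n, (N <= n)%nat ->
    forall z, Cnorm z <= Rad -> rhoS (g n z) (lim z) < eps.

Definition normal_fun (f : Cx -> Chat) : Prop :=
  meromorphic f /\
  forall h : nat -> Cx, exists phi, strictly_increasing phi /\
    loc_unif_cauchy (fun n => translate f (h (phi n))).

Definition in_N1 (f : Cx -> Chat) : Prop :=
  normal_fun f /\
  forall (h : nat -> Cx) (phi : nat -> nat) (g : Cx -> Chat),
    strictly_increasing phi ->
    loc_unif_conv (fun n => translate f (h (phi n))) g ->
    ~ (exists c : Chat, forall z, g z = c).

Definition away_from_zeros (f : Cx -> Chat) (del : R) (z : Cx) : Prop :=
  forall a, f a = Some C0 -> del <= Cnorm (Csub z a).
Definition away_from_poles (f : Cx -> Chat) (del : R) (z : Cx) : Prop :=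
  forall b, f b = None -> del <= Cnorm (Csub z b).

(* Main.v *)
(** Everything rests on the Cauchy formula on circles for pointwise differentiable functions: Goursat's bisection is run in the coordinates [(s, t)] of the homotopy [z0 + s (w t - z0)] contracting the circle [w] to [z0].  Expanding the kernel gives Taylor expansions with remainder for uniform limits, hence isolated zeros, Hurwitz's theorem and the Cauchy estimate.  If [|f|] were not bounded below off the discs around the zeros, translates of [f] that are zero-free on a disc about [0] would have a limit vanishing at [0]; by Hurwitz it vanishes near [0], by isolation of zeros along segments it vanishes everywhere, and a constant limit is excluded.  The upper bound is the same statement for [1 / f], and the bound on [f' / f] follows from both by the Cauchy estimate. *)

From Stdlib Require Import Reals Lra Lia Classical ClassicalEpsilon.
From Coquelicot Require Import Coquelicot.
Require Import Defs.
Open Scope R_scope.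

(** * Continuity, differentiability and path integrals *)

(** [meromorphic] gives a derivative at each point and says nothing about its continuity, so Green's
    formula or differentiation under the integral cannot yield Cauchy's theorem; hence Goursat. The
    contraction needs integrals only along scaled copies of one closed curve and along rays, and it
    may stop at a scale [s1 > 0], which is essential because it is applied to a difference quotient
    that is singular at the centre. A second obstacle is the limit of translates: the sequence is
    only Cauchy for the chordal metric, so its limit is not known to be meromorphic, and it is never
    built globally. Only its zero set is tracked, through [tends0]. Near a point of that set the
    values eventually lie in the unit disc, where chordal and Euclidean distances are comparable,
    and there the limit is a function into [C]. Even this local limit is not shown to be
    differentiable: it inherits Cauchy's formula, and that is enough. Poles need no separate
    analysis, since inversion is an isometry of the sphere. *)

Definition ctsC {U : UniformSpace} (f : U -> C) (x : U) : Prop :=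
  continuous (U := C_UniformSpace) f x.

Lemma ctsC_pair {U : UniformSpace} (f : U -> C) (x : U) :
  ctsC f x <-> continuous (fun y => fst (f y)) x /\ continuous (fun y => snd (f y)) x.
Proof.
split.
- intros H; split.
  + apply (continuous_comp f (fun p : C_UniformSpace => fst p)); [exact H|].
    destruct (f x); apply continuous_fst.
  + apply (continuous_comp f (fun p : C_UniformSpace => snd p)); [exact H|].
    destruct (f x); apply continuous_snd.
- intros [H1 H2] P [e He].
  generalize (H1 _ (locally_ball (fst (f x)) e)); intros K1.
  generalize (H2 _ (locally_ball (snd (f x)) e)); intros K2.
  unfold filtermap in *.
  apply (filter_imp (fun y => ball (fst (f x)) e (fst (f y)) /\ ball (snd (f x)) e (snd (f y)))).
  + intros y [B1 B2]; apply He; split; assumption.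
  + apply filter_and; assumption.
Qed.

Lemma ctsC_ext {U : UniformSpace} (f g : U -> C) (x : U) :
  (forall y, f y = g y) -> ctsC f x -> ctsC g x.
Proof. intros H; apply continuous_ext; exact H. Qed.

Lemma ctsC_const {U : UniformSpace} (c : C) (x : U) : ctsC (fun _ => c) x.
Proof. apply continuous_const. Qed.

Lemma ctsC_plus {U : UniformSpace} (f g : U -> C) (x : U) :
  ctsC f x -> ctsC g x -> ctsC (fun y => f y + g y)%C x.
Proof.
rewrite !ctsC_pair; intros [A B] [A' B']; split; simpl.
- apply (continuous_plus (V := R_NormedModule) _ _ _ A A').
- apply (continuous_plus (V := R_NormedModule) _ _ _ B B').
Qed.

Lemma ctsC_mult {U : UniformSpace} (f g : U -> C) (x : U) :
  ctsC f x -> ctsC g x -> ctsC (fun y => f y * g y)%C x.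
Proof.
rewrite !ctsC_pair; intros [A B] [A' B']; split; simpl.
- apply (continuous_minus (V := R_NormedModule) (fun y => fst (f y) * fst (g y))
    (fun y => snd (f y) * snd (g y))); apply (continuous_mult (K := R_AbsRing)); assumption.
- apply (continuous_plus (V := R_NormedModule) (fun y => fst (f y) * snd (g y))
    (fun y => snd (f y) * fst (g y))); apply (continuous_mult (K := R_AbsRing)); assumption.
Qed.

Lemma ctsC_opp {U : UniformSpace} (f : U -> C) (x : U) :
  ctsC f x -> ctsC (fun y => - f y)%C x.
Proof.
intros H; apply ctsC_ext with (fun y => (RtoC (-1)) * f y)%C.
- intros y; ring.
- apply ctsC_mult; [apply ctsC_const | exact H].
Qed.

Lemma ctsC_minus {U : UniformSpace} (f g : U -> C) (x : U) :
  ctsC f x -> ctsC g x -> ctsC (fun y => f y - g y)%C x.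
Proof. intros H K; apply ctsC_plus; [exact H | apply ctsC_opp, K]. Qed.

Lemma ctsC_inv {U : UniformSpace} (f : U -> C) (x : U) :
  ctsC f x -> f x <> RtoC 0 -> ctsC (fun y => / f y)%C x.
Proof.
rewrite !ctsC_pair; intros [A B] H.
assert (N : fst (f x) ^ 2 + snd (f x) ^ 2 <> 0).
{ intros E; apply H; apply injective_projections; simpl; nra. }
assert (K : continuous (fun y => / (fst (f y) ^ 2 + snd (f y) ^ 2)) x).
{ apply (continuous_comp (fun y => fst (f y) ^ 2 + snd (f y) ^ 2) Rinv).
  - apply (continuous_plus (V := R_NormedModule) (fun y => fst (f y) ^ 2)
      (fun y => snd (f y) ^ 2));
    apply (continuous_mult (K := R_AbsRing)); try assumption;
    apply (continuous_mult (K := R_AbsRing)); try assumption; apply continuous_const.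
  - apply continuous_Rinv; exact N. }
split; simpl; apply (continuous_mult (K := R_AbsRing)); try exact K.
- exact A.
- apply (continuous_opp (V := R_NormedModule)); exact B.
Qed.

Lemma ctsC_pow {U : UniformSpace} (f : U -> C) (x : U) (n : nat) :
  ctsC f x -> ctsC (fun y => f y ^ n)%C x.
Proof.
intros H; induction n as [|n IH]; simpl.
- apply ctsC_const.
- apply ctsC_mult; assumption.
Qed.

Lemma ctsC_comp {U : UniformSpace} (F : C -> C) (g : U -> C) (x : U) :
  ctsC g x -> ctsC (U := C_UniformSpace) F (g x) -> ctsC (fun y => F (g y)) x.
Proof. intros H K; apply (continuous_comp g F); assumption. Qed.

Lemma ctsC_id (z : C) : ctsC (U := C_UniformSpace) (fun y => y) z.
Proof. apply continuous_id. Qed.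

(** The balls of [C_UniformSpace] are products of intervals, that is squares; the one of half-side
    [d / sqrt 2] fits in the disc of radius [d]. *)
Lemma locally_Cmod (z : C) (P : C -> Prop) :
  locally (T := C_UniformSpace) z P <->
  exists d, 0 < d /\ forall y, Cmod (y - z) < d -> P y.
Proof.
split.
- intros [e He]; exists e; split; [apply cond_pos|].
  intros y Hy; apply He; apply (C_NormedModule_mixin_compat1 z y e Hy).
- intros [d [Hd H]].
  assert (H2 : 0 < sqrt 2) by (apply sqrt_lt_R0; lra).
  assert (P0 : 0 < d / sqrt 2) by (apply Rdiv_lt_0_compat; assumption).
  exists (mkposreal _ P0); intros y Hy; apply H.
  assert (K := C_NormedModule_mixin_compat2 z y _ Hy); simpl in K.
  replace (sqrt 2 * (d / sqrt 2)) with d in K by (field; lra); exact K.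
Qed.

Lemma ctsC_eps {U : UniformSpace} (f : U -> C) (x : U) :
  ctsC f x <-> forall eps, 0 < eps -> locally x (fun y => Cmod (f y - f x) < eps).
Proof.
split.
- intros H eps He; apply (H (fun w => Cmod (w - f x) < eps)).
  apply locally_Cmod; exists eps; split; auto.
- intros H P HP.
  destruct (proj1 (locally_Cmod _ _) HP) as [d [Hd K]].
  unfold filtermap; apply filter_imp with (2 := H d Hd); intros y; apply K.
Qed.

Lemma Cmod_sym (a b : C) : Cmod (a - b) = Cmod (b - a).
Proof. replace (a - b)%C with (- (b - a))%C by ring; apply Cmod_opp. Qed.

Lemma Cmod_le_dist (a b : C) : Cmod a <= Cmod b + Cmod (a - b).
Proof. replace a with (b + (a - b))%C at 1 by ring; apply Cmod_triangle. Qed.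

(* Only the crude bound with the factor [2] is available for this componentwise integral; constants never matter below. *)
Definition CInt (f : R -> C) (a b : R) : C :=
  (RInt (fun t => fst (f t)) a b, RInt (fun t => snd (f t)) a b).

Definition ctson (f : R -> C) (a b : R) : Prop :=
  forall t, a <= t <= b -> ctsC (U := R_UniformSpace) f t.

Lemma ctson_int (f : R -> C) (a b : R) : a <= b -> ctson f a b ->
  ex_RInt (fun t => fst (f t)) a b /\ ex_RInt (fun t => snd (f t)) a b.
Proof.
intros Hab H; split; apply (ex_RInt_continuous (V := R_CompleteNormedModule));
rewrite Rmin_left, Rmax_right by assumption; intros t Ht;
destruct (proj1 (ctsC_pair _ _) (H t Ht)); assumption.
Qed.

Lemma CInt_ext (f g : R -> C) (a b : R) : a <= b ->
  (forall t, a <= t <= b -> f t = g t) -> CInt f a b = CInt g a b.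
Proof.
intros Hab H; unfold CInt; f_equal; apply RInt_ext;
rewrite Rmin_left, Rmax_right by assumption; intros t Ht; rewrite H; auto; lra.
Qed.

Lemma CInt_plus (f g : R -> C) (a b : R) : a <= b -> ctson f a b -> ctson g a b ->
  CInt (fun t => f t + g t)%C a b = (CInt f a b + CInt g a b)%C.
Proof.
intros Hab Hf Hg.
destruct (ctson_int f a b Hab Hf); destruct (ctson_int g a b Hab Hg).
unfold CInt, Cplus; simpl; f_equal; apply (RInt_plus (V := R_CompleteNormedModule)); assumption.
Qed.

Lemma CInt_scal (c : C) (f : R -> C) (a b : R) : a <= b -> ctson f a b ->
  CInt (fun t => c * f t)%C a b = (c * CInt f a b)%C.
Proof.
intros Hab Hf.
destruct (ctson_int f a b Hab Hf) as [H1 H2].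
assert (E : forall k (g : R -> R), ex_RInt g a b -> RInt (fun t => k * g t) a b = k * RInt g a b).
{ intros; apply (RInt_scal (V := R_CompleteNormedModule)); assumption. }
assert (X : forall k (g : R -> R), ex_RInt g a b -> ex_RInt (fun t => k * g t) a b).
{ intros; apply (ex_RInt_scal (V := R_CompleteNormedModule)); assumption. }
unfold CInt, Cmult; simpl; f_equal.
- rewrite <- !E by assumption.
  apply (RInt_minus (V := R_CompleteNormedModule)); apply X; assumption.
- rewrite <- !E by assumption.
  apply (RInt_plus (V := R_CompleteNormedModule)); apply X; assumption.
Qed.

Lemma CInt_minus (f g : R -> C) (a b : R) : a <= b -> ctson f a b -> ctson g a b ->
  CInt (fun t => f t - g t)%C a b = (CInt f a b - CInt g a b)%C.
Proof.
intros Hab Hf Hg.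
rewrite (CInt_ext _ (fun t => f t + (RtoC (-1)) * g t)%C) by (auto; intros; ring).
rewrite CInt_plus, CInt_scal; auto.
- ring.
- intros t Ht; apply ctsC_mult; [apply ctsC_const | apply Hg, Ht].
Qed.

Lemma CInt_Chasles (f : R -> C) (a b c : R) : a <= b <= c -> ctson f a c ->
  CInt f a c = (CInt f a b + CInt f b c)%C.
Proof.
intros [Hab Hbc] Hf.
assert (F1 : ctson f a b) by (intros t Ht; apply Hf; lra).
assert (F2 : ctson f b c) by (intros t Ht; apply Hf; lra).
destruct (ctson_int f a b Hab F1); destruct (ctson_int f b c Hbc F2).
unfold CInt, Cplus; simpl; f_equal; symmetry;
apply (RInt_Chasles (V := R_CompleteNormedModule)); assumption.
Qed.

Lemma CInt_bound (f : R -> C) (a b M : R) : a <= b -> ctson f a b ->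
  (forall t, a <= t <= b -> Cmod (f t) <= M) -> Cmod (CInt f a b) <= 2 * M * (b - a).
Proof.
intros Hab Hf HM.
destruct (ctson_int f a b Hab Hf) as [I1 I2].
assert (B1 : Rabs (fst (CInt f a b)) <= (b - a) * M).
{ apply abs_RInt_le_const; try assumption.
  intros t Ht; eapply Rle_trans; [apply re_le_Cmod | apply HM, Ht]. }
assert (B2 : Rabs (snd (CInt f a b)) <= (b - a) * M).
{ apply abs_RInt_le_const; try assumption.
  intros t Ht; eapply Rle_trans; [| apply HM, Ht].
  eapply Rle_trans; [apply Rmax_r | apply Rmax_Cmod]. }
assert (T : Cmod (CInt f a b) <= Rabs (fst (CInt f a b)) + Rabs (snd (CInt f a b))).
{ unfold Cmod; apply Rsqr_incr_0_var.
  - rewrite Rsqr_sqrt by nra. unfold Rsqr.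
    assert (U := Rabs_pos (fst (CInt f a b))); assert (V := Rabs_pos (snd (CInt f a b))).
    rewrite <- (pow2_abs (fst (CInt f a b))), <- (pow2_abs (snd (CInt f a b))); nra.
  - assert (U := Rabs_pos (fst (CInt f a b))); assert (V := Rabs_pos (snd (CInt f a b))); lra. }
lra.
Qed.

Definition pderiv (g : R -> C) (t : R) (d : C) : Prop :=
  is_derive (fun u => fst (g u)) t (fst d) /\ is_derive (fun u => snd (g u)) t (snd d).

Lemma pderiv_ctsC (g : R -> C) (t : R) (d : C) :
  pderiv g t d -> ctsC (U := R_UniformSpace) g t.
Proof.
intros [A B]; apply ctsC_pair; split;
apply (ex_derive_continuous (V := R_NormedModule)); eexists; eassumption.
Qed.

Lemma pderiv_const (c : C) (t : R) : pderiv (fun _ => c) t (RtoC 0).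
Proof. split; simpl; apply (is_derive_const (V := R_NormedModule)). Qed.

Lemma pderiv_plus (f g : R -> C) (t : R) (a b : C) :
  pderiv f t a -> pderiv g t b -> pderiv (fun u => f u + g u)%C t (a + b)%C.
Proof.
intros [A B] [A' B']; split; simpl; apply (is_derive_plus (V := R_NormedModule)); assumption.
Qed.

Lemma pderiv_eq (f : R -> C) (t : R) (a b : C) : a = b -> pderiv f t a -> pderiv f t b.
Proof. now intros ->. Qed.

Lemma pderiv_mult (f g : R -> C) (t : R) (a b : C) :
  pderiv f t a -> pderiv g t b ->
  pderiv (fun u => f u * g u)%C t (a * g t + f t * b)%C.
Proof.
intros [A B] [A' B']; split; simpl.
- replace (fst a * fst (g t) - snd a * snd (g t) + (fst (f t) * fst b - snd (f t) * snd b))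
    with ((fst a * fst (g t) + fst (f t) * fst b) - (snd a * snd (g t) + snd (f t) * snd b))
    by ring.
  apply (is_derive_minus (V := R_NormedModule) (fun u => fst (f u) * fst (g u))
    (fun u => snd (f u) * snd (g u)));
  apply (is_derive_mult (K := R_AbsRing)); try assumption; intros; apply Rmult_comm.
- replace (fst a * snd (g t) + snd a * fst (g t) + (fst (f t) * snd b + snd (f t) * fst b))
    with ((fst a * snd (g t) + fst (f t) * snd b) + (snd a * fst (g t) + snd (f t) * fst b))
    by ring.
  apply (is_derive_plus (V := R_NormedModule) (fun u => fst (f u) * snd (g u))
    (fun u => snd (f u) * fst (g u)));
  apply (is_derive_mult (K := R_AbsRing)); try assumption; intros; apply Rmult_comm.
Qed.

Lemma CInt_FTC (P p : R -> C) (a b : R) : a <= b ->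
  (forall t, a <= t <= b -> pderiv P t (p t)) -> ctson p a b ->
  CInt p a b = (P b - P a)%C.
Proof.
intros Hab HP Hp; unfold CInt, Cminus, Cplus, Copp; simpl; f_equal;
apply is_RInt_unique; apply (is_RInt_derive (V := R_CompleteNormedModule)
  (fun t => _ (P t)) (fun t => _ (p t)));
rewrite Rmin_left, Rmax_right by assumption; intros t Ht;
try (apply HP, Ht); apply (proj1 (ctsC_pair _ _) (Hp t Ht)).
Qed.

(* Carathéodory's form of complex differentiability: products, quotients and compositions reduce to continuity. *)
Definition Cdif (f : C -> C) (z : C) : Prop :=
  exists phi : C -> C, ctsC (U := C_UniformSpace) phi z /\
    forall y, f y = (f z + phi y * (y - z))%C.

Lemma Cdif_ctsC (f : C -> C) (z : C) : Cdif f z -> ctsC (U := C_UniformSpace) f z.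
Proof.
intros [phi [H K]]; apply ctsC_ext with (fun y => f z + phi y * (y - z))%C.
- intros y; symmetry; apply K.
- apply ctsC_plus; [apply ctsC_const|]; apply ctsC_mult; [exact H|].
  apply ctsC_minus; [apply ctsC_id | apply ctsC_const].
Qed.

Lemma Cdif_ext (f g : C -> C) (z : C) : (forall y, f y = g y) -> Cdif f z -> Cdif g z.
Proof.
intros E [phi [H K]]; exists phi; split; [exact H|].
intros y; rewrite <- !E; apply K.
Qed.

Lemma Cdif_shift (f : C -> C) (p z : C) : Cdif f (p + z)%C -> Cdif (fun y => f (p + y)%C) z.
Proof.
intros [phi [H K]]; exists (fun y => phi (p + y)%C); split.
- apply (ctsC_comp phi (U := C_UniformSpace) (fun y => p + y)%C); [|exact H].
  apply ctsC_plus; [apply ctsC_const | apply ctsC_id].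
- intros y; rewrite K at 1; f_equal; f_equal; ring.
Qed.

Lemma Cdif_const (c z : C) : Cdif (fun _ => c) z.
Proof. exists (fun _ => RtoC 0); split; [apply ctsC_const | intros; ring]. Qed.

Lemma Cdif_id (z : C) : Cdif (fun y => y) z.
Proof. exists (fun _ => RtoC 1); split; [apply ctsC_const | intros; ring]. Qed.

Lemma Cdif_minus (f g : C -> C) (z : C) :
  Cdif f z -> Cdif g z -> Cdif (fun y => f y - g y)%C z.
Proof.
intros [p [Hp Kp]] [q [Hq Kq]]; exists (fun y => p y - q y)%C; split.
- apply ctsC_minus; assumption.
- intros y; rewrite (Kp y), (Kq y); ring.
Qed.

Lemma Cdif_mult (f g : C -> C) (z : C) :
  Cdif f z -> Cdif g z -> Cdif (fun y => f y * g y)%C z.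
Proof.
intros Hf Hg; assert (Cg := Cdif_ctsC g z Hg).
destruct Hf as [p [Hp Kp]]; destruct Hg as [q [Hq Kq]].
exists (fun y => p y * g y + f z * q y)%C; split.
- apply ctsC_plus; apply ctsC_mult; try assumption; apply ctsC_const.
- intros y; rewrite (Kp y), (Kq y); ring.
Qed.

(* The quotient [phi] of the inverse is corrected where [f] vanishes away from [z], since [/ 0 = 0]. *)
Lemma Cdif_inv (f : C -> C) (z : C) :
  Cdif f z -> f z <> RtoC 0 -> Cdif (fun y => / f y)%C z.
Proof.
intros Hf N; assert (Cf := Cdif_ctsC f z Hf).
destruct Hf as [p [Hp Kp]].
exists (fun y => if excluded_middle_informative (f y = RtoC 0)
  then (/ f y - / f z) / (y - z) else - p y / (f y * f z))%C; split.
- assert (G : ctsC (U := C_UniformSpace) (fun y => - p y / (f y * f z))%C z).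
  { apply ctsC_mult; [apply ctsC_opp, Hp|]; apply ctsC_inv.
    - apply ctsC_mult; [exact Cf | apply ctsC_const].
    - apply Cmult_neq_0; exact N. }
  apply (continuous_ext_loc (U := C_UniformSpace) (T := C_UniformSpace) _ (fun y => - p y / (f y * f z))%C);
    [|exact G].
  assert (Q := proj1 (ctsC_eps f z) Cf (Cmod (f z)) (proj1 (Cmod_gt_0 _) N)).
  apply filter_imp with (2 := Q); intros y Hy.
  destruct (excluded_middle_informative (f y = RtoC 0)) as [E|E]; [|reflexivity].
  exfalso; rewrite E, Cmod_sym in Hy.
  replace (f z - 0)%C with (f z) in Hy by ring; lra.
- intros y; destruct (excluded_middle_informative (f y = RtoC 0)) as [E|E].
  + assert (y <> z) by (intros ->; contradiction).
    generalize (/ f y)%C (/ f z)%C; intros c d; field; intros W; apply H.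
    replace y with (y - z + z)%C by ring; rewrite W; ring.
  + assert (D : (f y - f z = p y * (y - z))%C) by (rewrite (Kp y) at 1; ring).
    replace (/ f z + - p y / (f y * f z) * (y - z))%C
      with (/ f z - (p y * (y - z)) / (f y * f z))%C by (field; split; assumption).
    rewrite <- D; field; split; assumption.
Qed.

(** * Goursat's theorem *)

(** Every left end lies below every right end ([Cross]), so the supremum of the left ends belongs to
    all the intervals. *)
Lemma nested_intervals (s : nat -> R) (a : R) : 0 <= a ->
  (forall n, s n <= s (S n)) -> (forall n, s (S n) + a / 2 ^ S n <= s n + a / 2 ^ n) ->
  exists x, forall n, s n <= x <= s n + a / 2 ^ n.
Proof.
intros Ha Hinc Hdec.
assert (Pos : forall n, 0 <= a / 2 ^ n).
{ intros n; apply Rdiv_le_0_compat; [exact Ha | apply pow_lt; lra]. }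
assert (Mi : forall n k, s n <= s (n + k)%nat).
{ intros n k; induction k as [|k IH]; [rewrite Nat.add_0_r; lra|].
  rewrite Nat.add_succ_r; eapply Rle_trans; [exact IH | apply Hinc]. }
assert (Md : forall n k, s (n + k)%nat + a / 2 ^ (n + k) <= s n + a / 2 ^ n).
{ intros n k; induction k as [|k IH]; [rewrite Nat.add_0_r; lra|].
  rewrite Nat.add_succ_r; eapply Rle_trans; [apply Hdec | exact IH]. }
assert (Cross : forall m n, s m <= s n + a / 2 ^ n).
{ intros m n; apply Rle_trans with (s (n + m)%nat).
  - rewrite Nat.add_comm; apply Mi.
  - specialize (Md n m); specialize (Pos (n + m)%nat); lra. }
destruct (completeness (fun y => exists n, y = s n)) as [x [U L]].
- exists (s 0%nat + a / 2 ^ 0); intros y [n ->]; apply Cross.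
- exists (s 0%nat); now exists 0%nat.
- exists x; intros n; split.
  + apply U; now exists n.
  + apply L; intros y [m ->]; apply Cross.
Qed.

(* [nu s t a b] is the value of a rectangle function on [[s, s + a] x [t, t + b]]. *)
Lemma bisection_zero (nu : R -> R -> R -> R -> C) (s0 t0 a b : R) :
  0 <= a -> 0 <= b ->
  (forall s t a' b', 0 <= a' -> 0 <= b' -> s0 <= s -> s + (a' + a') <= s0 + a ->
     t0 <= t -> t + (b' + b') <= t0 + b ->
     nu s t (a' + a') (b' + b') =
       (nu s t a' b' + nu (s + a')%R t a' b' + (nu s (t + b')%R a' b' + nu (s + a')%R (t + b')%R a' b'))%C) ->
  (forall x y eps, s0 <= x <= s0 + a -> t0 <= y <= t0 + b -> 0 < eps ->
     exists d, 0 < d /\ forall r s t, 0 <= r < d ->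
       s0 <= s -> s + a * r <= s0 + a -> t0 <= t -> t + b * r <= t0 + b ->
       s <= x <= s + a * r -> t <= y <= t + b * r ->
       Cmod (nu s t (a * r) (b * r)) <= eps * r ^ 2) ->
  nu s0 t0 a b = RtoC 0.
Proof.
intros Ha Hb Hsplit Hloc.
destruct (Req_dec (Cmod (nu s0 t0 a b)) 0) as [E|N]; [apply Cmod_eq_0, E|exfalso].
set (m := Cmod (nu s0 t0 a b)) in *.
assert (Hm : 0 < m) by (assert (0 <= m) by apply Cmod_ge_0; lra).
(* One quarter of a good rectangle carries at least a quarter of its value, so after [n] halvings of
   the sides [m / 4 ^ n] is still left. *)
pose (good := fun n (p : R * R) =>
  s0 <= fst p /\ fst p + a / 2 ^ n <= s0 + a /\ t0 <= snd p /\ snd p + b / 2 ^ n <= t0 + b /\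
  m / 4 ^ n <= Cmod (nu (fst p) (snd p) (a / 2 ^ n) (b / 2 ^ n))).
assert (Step : forall n p, good n p -> exists q, good (S n) q /\
  fst p <= fst q /\ fst q + a / 2 ^ S n <= fst p + a / 2 ^ n /\
  snd p <= snd q /\ snd q + b / 2 ^ S n <= snd p + b / 2 ^ n).
{ intros n [s t] [G1 [G2 [G3 [G4 G5]]]]; simpl fst in *; simpl snd in *.
  assert (P2 : 0 < 2 ^ n) by (apply pow_lt; lra).
  assert (P4 : 0 < 4 ^ n) by (apply pow_lt; lra).
  set (a' := a / 2 ^ S n); set (b' := b / 2 ^ S n).
  assert (Ea : a / 2 ^ n = a' + a') by (unfold a'; simpl; field; lra).
  assert (Eb : b / 2 ^ n = b' + b') by (unfold b'; simpl; field; lra).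
  assert (Pa : 0 <= a') by (apply Rdiv_le_0_compat; [exact Ha | apply pow_lt; lra]).
  assert (Pb : 0 <= b') by (apply Rdiv_le_0_compat; [exact Hb | apply pow_lt; lra]).
  assert (Em : m / 4 ^ n = 4 * (m / 4 ^ S n)) by (simpl; field; lra).
  rewrite Ea, Eb in *; rewrite Em in G5.
  rewrite Hsplit in G5 by assumption.
  set (k := m / 4 ^ S n) in *.
  destruct (Rle_lt_dec k (Cmod (nu s t a' b'))) as [H1|H1];
    [exists (s, t); unfold good; fold a' b' k; simpl fst; simpl snd; repeat split; lra|].
  destruct (Rle_lt_dec k (Cmod (nu (s + a') t a' b'))) as [H2|H2];
    [exists (s + a', t); unfold good; fold a' b' k; simpl fst; simpl snd; repeat split; lra|].
  destruct (Rle_lt_dec k (Cmod (nu s (t + b') a' b'))) as [H3|H3];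
    [exists (s, t + b'); unfold good; fold a' b' k; simpl fst; simpl snd; repeat split; lra|].
  destruct (Rle_lt_dec k (Cmod (nu (s + a') (t + b') a' b'))) as [H4|H4];
    [exists (s + a', t + b'); unfold good; fold a' b' k; simpl fst; simpl snd; repeat split; lra|].
  exfalso.
  assert (T := Cmod_triangle (nu s t a' b' + nu (s + a')%R t a' b')
    (nu s (t + b')%R a' b' + nu (s + a')%R (t + b')%R a' b')).
  assert (T1 := Cmod_triangle (nu s t a' b') (nu (s + a') t a' b')).
  assert (T2 := Cmod_triangle (nu s (t + b') a' b') (nu (s + a') (t + b') a' b')).
  lra. }
(* Choice is made total by leaving bad rectangles unchanged, so that [seqn] is a plain fixpoint;
   [Hgood] shows afterwards that this branch is never taken. *)
pose (next := fun n (p : R * R) =>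
  match excluded_middle_informative (good n p) with
  | left G => proj1_sig (constructive_indefinite_description _ (Step n p G))
  | right _ => p end).
pose (seqn := fix seqn n := match n with O => (s0, t0) | S n => next n (seqn n) end).
assert (Hnext : forall n p, good n p -> good (S n) (next n p) /\
  fst p <= fst (next n p) /\ fst (next n p) + a / 2 ^ S n <= fst p + a / 2 ^ n /\
  snd p <= snd (next n p) /\ snd (next n p) + b / 2 ^ S n <= snd p + b / 2 ^ n).
{ intros n p G; unfold next.
  destruct (excluded_middle_informative (good n p)) as [G'|G']; [|contradiction].
  exact (proj2_sig (constructive_indefinite_description _ (Step n p G'))). }
assert (Hgood : forall n, good n (seqn n)).
{ intros n; induction n as [|n IH].
  - unfold good; simpl seqn; simpl fst; simpl snd.
    replace (a / 2 ^ 0) with a by (simpl; field); replace (b / 2 ^ 0) with b by (simpl; field).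
    replace (m / 4 ^ 0) with m by (simpl; field). repeat split; try lra; apply Rle_refl.
  - exact (proj1 (Hnext n _ IH)). }
destruct (nested_intervals (fun n => fst (seqn n)) a Ha) as [x Hx];
  [intros n; apply (Hnext n _ (Hgood n)) | intros n; apply (Hnext n _ (Hgood n)) |].
destruct (nested_intervals (fun n => snd (seqn n)) b Hb) as [y Hy];
  [intros n; apply (Hnext n _ (Hgood n)) | intros n; apply (Hnext n _ (Hgood n)) |].
assert (X0 : s0 <= x <= s0 + a).
{ specialize (Hx 0%nat); simpl in Hx; replace (a / 1) with a in Hx by field; exact Hx. }
assert (Y0 : t0 <= y <= t0 + b).
{ specialize (Hy 0%nat); simpl in Hy; replace (b / 1) with b in Hy by field; exact Hy. }
(* With [r = / 2 ^ n] the local estimate gives at most [m / 2 / 4 ^ n], half of what a good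
   rectangle carries. *)
destruct (Hloc x y (m / 2) X0 Y0) as [d [Hd Hs]]; [lra|].
destruct (pow_lt_1_zero (/ 2)) with (y := d) as [n Hn]; [rewrite Rabs_pos_eq; lra | lra |].
specialize (Hn n (le_n n)).
assert (P2 : 0 < 2 ^ n) by (apply pow_lt; lra).
rewrite pow_inv in Hn.
assert (Pi2 : 0 < / 2 ^ n) by (apply Rinv_0_lt_compat; exact P2).
rewrite Rabs_pos_eq in Hn by lra.
destruct (Hgood n) as [G1 [G2 [G3 [G4 G5]]]].
specialize (Hx n); specialize (Hy n).
specialize (Hs (/ 2 ^ n) (fst (seqn n)) (snd (seqn n))).
unfold Rdiv in Hx, Hy, G2, G4, G5.
assert (B := Hs (conj (Rlt_le _ _ Pi2) Hn) G1 G2 G3 G4 Hx Hy).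
replace ((/ 2 ^ n) ^ 2) with (/ 4 ^ n) in B.
- assert (0 < / 4 ^ n) by (apply Rinv_0_lt_compat, pow_lt; lra). nra.
- rewrite pow_inv. f_equal. rewrite <- pow_mult, Nat.mul_comm, pow_mult.
  f_equal; lra.
Qed.

(* The affine part [A + B w] of [F] is integrated exactly by its primitive. *)
Lemma path_estimate (F : C -> C) (g g' : R -> C) (A B : C) (eta L a b : R) :
  a <= b -> 0 <= eta ->
  (forall t, a <= t <= b -> pderiv g t (g' t)) -> ctson g' a b ->
  ctson (fun t => F (g t)) a b ->
  (forall t, a <= t <= b -> Cmod (g' t) <= L) ->
  (forall t, a <= t <= b -> Cmod (F (g t) - (A + B * g t)) <= eta) ->
  Cmod (CInt (fun t => F (g t) * g' t)%C a b -
    ((A * g b + B / 2 * (g b * g b)) - (A * g a + B / 2 * (g a * g a))))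
  <= 2 * (eta * L) * (b - a).
Proof.
intros Hab He Hg Hg' HF HL HR.
assert (Cg : ctson g a b) by (intros t Ht; eapply pderiv_ctsC, Hg, Ht).
assert (CA : ctson (fun t => (A + B * g t) * g' t)%C a b).
{ intros t Ht; apply ctsC_mult; [|apply Hg', Ht].
  apply ctsC_plus; [apply ctsC_const|].
  apply ctsC_mult; [apply ctsC_const | apply Cg, Ht]. }
assert (CF : ctson (fun t => F (g t) * g' t)%C a b).
{ intros t Ht; apply ctsC_mult; [apply HF, Ht | apply Hg', Ht]. }
rewrite <- (CInt_FTC (fun t => A * g t + B / 2 * (g t * g t))%C
  (fun t => (A + B * g t) * g' t)%C); [|exact Hab| |exact CA].
- rewrite <- CInt_minus by assumption.
  apply CInt_bound; [exact Hab| |].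
  + intros t Ht; apply ctsC_minus; [apply CF, Ht | apply CA, Ht].
  + intros t Ht.
    replace (F (g t) * g' t - (A + B * g t) * g' t)%C
      with ((F (g t) - (A + B * g t)) * g' t)%C by ring.
    rewrite Cmod_mult; apply Rmult_le_compat; try apply Cmod_ge_0; auto.
- intros t Ht.
  assert (P := Hg t Ht).
  eapply pderiv_eq; [|apply pderiv_plus;
    [apply pderiv_mult; [apply pderiv_const | exact P]
    |apply pderiv_mult; [apply pderiv_const | apply pderiv_mult; exact P]]].
  replace (RtoC 2) with (RtoC 1 + RtoC 1)%C
    by (rewrite <- RtoC_plus; f_equal; lra).
  field.
Qed.

(* The two sides [t = 0] and [t = T] of the parameter rectangle cancel since [E] is closed. *)
Lemma goursat_homothety (F : C -> C) (E E' : R -> C) (L T s1 : R) :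
  0 < s1 <= 1 -> 0 <= T -> 0 <= L ->
  (forall t, 0 <= t <= T -> pderiv E t (E' t)) -> ctson E' 0 T ->
  (forall t, 0 <= t <= T -> Cmod (E t) <= L /\ Cmod (E' t) <= L) ->
  (forall t u, 0 <= t <= T -> 0 <= u <= T -> Cmod (E t - E u) <= L * Rabs (t - u)) ->
  E 0 = E T ->
  (forall s t, s1 <= s <= 1 -> 0 <= t <= T -> Cdif F (RtoC s * E t)%C) ->
  CInt (fun t => F (E t) * E' t)%C 0 T =
  CInt (fun t => F (RtoC s1 * E t) * (RtoC s1 * E' t))%C 0 T.
Proof.
intros Hs1 HT HL HE HE' HB HLip Hper HF.
assert (CE : ctson E 0 T) by (intros t Ht; eapply pderiv_ctsC, HE, Ht).
assert (CF1 : forall s, s1 <= s <= 1 -> ctson (fun t => F (RtoC s * E t)%C) 0 T).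
{ intros s Hs t Ht.
  apply (ctsC_comp F (U := R_UniformSpace) (fun t => RtoC s * E t)%C).
  - apply ctsC_mult; [apply ctsC_const | apply CE, Ht].
  - apply Cdif_ctsC, HF; assumption. }
assert (DR : forall t, pderiv RtoC t (RtoC 1)).
{ intros t; split; simpl; [apply (is_derive_id (K := R_AbsRing)) |
    apply (is_derive_const (V := R_NormedModule))]. }
assert (CF2 : forall t, 0 <= t <= T -> ctson (fun s => F (RtoC s * E t)%C) s1 1).
{ intros t Ht s Hs.
  apply (ctsC_comp F (U := R_UniformSpace) (fun s => RtoC s * E t)%C).
  - apply ctsC_mult; [eapply pderiv_ctsC, DR | apply ctsC_const].
  - apply Cdif_ctsC, HF; assumption. }
(* [H] integrates [F] along the scaled curve [t => s * E t], [V] along the ray [s => s * E t]. *)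
pose (H := fun s a b => CInt (fun t => F (RtoC s * E t) * (RtoC s * E' t))%C a b).
pose (V := fun t a b => CInt (fun s => F (RtoC s * E t) * E t)%C a b).
assert (CH : forall s, s1 <= s <= 1 ->
  ctson (fun t => F (RtoC s * E t) * (RtoC s * E' t))%C 0 T).
{ intros s Hs t Ht; apply ctsC_mult; [apply CF1; assumption|].
  apply ctsC_mult; [apply ctsC_const | apply HE', Ht]. }
assert (CV : forall t, 0 <= t <= T -> ctson (fun s => F (RtoC s * E t) * E t)%C s1 1).
{ intros t Ht s Hs; apply ctsC_mult; [apply CF2; assumption | apply ctsC_const]. }
assert (ChH : forall s a b c, s1 <= s <= 1 -> 0 <= a -> a <= b <= c -> c <= T ->
  H s a c = (H s a b + H s b c)%C).
{ intros s a b c Hs Ha Hb Hc; apply CInt_Chasles; [exact Hb|].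
  intros t Ht; apply CH; [assumption | lra]. }
assert (ChV : forall t a b c, 0 <= t <= T -> s1 <= a -> a <= b <= c -> c <= 1 ->
  V t a c = (V t a b + V t b c)%C).
{ intros t a b c Ht Ha Hb Hc; apply CInt_Chasles; [exact Hb|].
  intros s Hs; apply CV; [assumption | lra]. }
(* The integral of [F] over the image of the positively oriented boundary of the parameter
   rectangle. *)
pose (nu := fun s t a b =>
  (H (s + a)%R t (t + b)%R - H s t (t + b)%R - (V (t + b)%R s (s + a)%R - V t s (s + a)%R))%C).
assert (Z : nu s1 0 (1 - s1) T = RtoC 0).
{ apply bisection_zero; try lra.
  - intros s t a b Ha Hb I1 I2 I3 I4; unfold nu.
    rewrite <- !Rplus_assoc in *.
    rewrite (ChH (s + a + a) t (t + b) (t + b + b)) by lra.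
    rewrite (ChH s t (t + b) (t + b + b)) by lra.
    rewrite (ChV (t + b + b) s (s + a) (s + a + a)) by lra.
    rewrite (ChV t s (s + a) (s + a + a)) by lra.
    ring.
  - intros x y eps Hx Hy Heps.
    set (p := (RtoC x * E y)%C).
    destruct (HF x y) as [phi [Cphi Kphi]]; [lra | lra |]. fold p in Cphi, Kphi.
    (* [D] dominates both sides [1 - s1] and [T] of the parameter rectangle. [K] collects the final
       error: four sides, each contributing at most [2 * (eta * L) * (D * r)] with
       [eta = e' * (2 * L * D * r)]. *)
    set (D := 1 + T + 1).
    set (K := 8 * L * L * D * D * 2).
    assert (HK : 0 <= K) by (unfold K, D; nra).
    set (e' := eps / (K + 1)).
    assert (He' : 0 < e') by (apply Rdiv_lt_0_compat; lra).
    destruct (proj1 (locally_Cmod p _) (proj1 (ctsC_eps phi p) Cphi e' He')) as [dl [Hdl Q]].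
    (* The image of a rectangle of scale [r] around the parameters of [p] stays within
       [2 * L * D * r] of [p]; this must be less than [dl], so that [phi] is [e']-close to [phi p]
       there. *)
    exists (dl / (2 * L * D + 1)); split.
    { apply Rdiv_lt_0_compat; [exact Hdl | unfold D; nra]. }
    intros r s t Hr I1 I2 I3 I4 I5 I6.
    assert (Hsmall : 2 * L * D * r < dl).
    { destruct Hr as [Hr0 Hr].
      assert (PD : 0 < 2 * L * D + 1) by (unfold D; nra).
      apply (Rmult_lt_compat_r _ _ _ PD) in Hr.
      replace (dl / (2 * L * D + 1) * (2 * L * D + 1)) with dl in Hr by (field; lra). lra. }
    assert (Da : (1 - s1) * r <= D * r) by (unfold D; nra).
    assert (Db : T * r <= D * r) by (unfold D; nra).
    assert (Pa : 0 <= (1 - s1) * r) by nra.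
    assert (Pb : 0 <= T * r) by nra.
    set (a := (1 - s1) * r) in *; set (b := T * r) in *.
    (* [A + phi p * w] is the affine approximation of [F] at [p]; its deviation from [F] is
       [(phi w - phi p) * (w - p)]. *)
    set (A := (F p - phi p * p)%C).
    set (eta := e' * (2 * L * D * r)).
    assert (Heta : 0 <= eta) 
      by (apply Rmult_le_pos; [lra | assert (0 <= D * r) by lra; nra]).
    assert (Main : forall u v, s <= u <= s + a -> t <= v <= t + b ->
      Cmod (F (RtoC u * E v)%C - (A + phi p * (RtoC u * E v))) <= eta).
    { intros u v Hu Hv; unfold A. set (w := (RtoC u * E v)%C).
      rewrite (Kphi w).
      replace (F p + phi w * (w - p) - (F p - phi p * p + phi p * w))%C
        with ((phi w - phi p) * (w - p))%C by ring.
      assert (Dw : Cmod (w - p) <= 2 * L * D * r).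
      { unfold w, p.
        replace (RtoC u * E v - RtoC x * E y)%C
          with (RtoC (u - x)%R * E v + RtoC x * (E v - E y))%C
          by (rewrite RtoC_minus; ring).
        eapply Rle_trans; [apply Cmod_triangle|].
        rewrite !Cmod_mult, !Cmod_R.
        assert (B1 : Rabs (u - x) <= D * r) by (apply Rabs_le; lra).
        assert (B2 : Rabs (v - y) <= D * r) by (apply Rabs_le; lra).
        assert (B3 := proj1 (HB v ltac:(lra))).
        assert (B4 := HLip v y ltac:(lra) ltac:(lra)).
        assert (B5 : Rabs x <= 1) by (apply Rabs_le; lra).
        assert (Y1 : Rabs (u - x) * Cmod (E v) <= (D * r) * L)
          by (apply Rmult_le_compat; auto using Rabs_pos, Cmod_ge_0).
        assert (Y2 : L * Rabs (v - y) <= L * (D * r)) by (apply Rmult_le_compat_l; auto).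
        assert (Y3 : Rabs x * Cmod (E v - E y) <= 1 * (L * (D * r)))
          by (apply Rmult_le_compat; auto using Rabs_pos, Cmod_ge_0; lra).
        lra. }
      rewrite Cmod_mult; unfold eta; apply Rmult_le_compat; try apply Cmod_ge_0; [|exact Dw].
      apply Rlt_le, Q; lra. }
    assert (EH : forall u, s <= u <= s + a -> Cmod (H u t (t + b) -
      ((A * (RtoC u * E (t + b)%R) + phi p / 2 * ((RtoC u * E (t + b)%R) * (RtoC u * E (t + b)%R)))
       - (A * (RtoC u * E t) + phi p / 2 * ((RtoC u * E t) * (RtoC u * E t)))))
      <= 2 * (eta * L) * (t + b - t)).
    { intros u Hu; apply (path_estimate F (fun t => RtoC u * E t)%C (fun t => RtoC u * E' t)%C);
        try lra.
      - intros v Hv; eapply pderiv_eq;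
          [|apply pderiv_mult; [apply pderiv_const | apply HE; lra]]. cbv beta. ring.
      - intros v Hv; apply ctsC_mult; [apply ctsC_const | apply HE'; lra].
      - intros v Hv; apply CF1; lra.
      - intros v Hv; rewrite Cmod_mult, Cmod_R, Rabs_pos_eq by lra.
        assert (Q2 := proj2 (HB v ltac:(lra))). assert (Q3 := Cmod_ge_0 (E' v)). nra.
      - intros v Hv; apply Main; lra. }
    assert (EV : forall v, t <= v <= t + b -> Cmod (V v s (s + a) -
      ((A * (RtoC (s + a)%R * E v) + phi p / 2 * ((RtoC (s + a)%R * E v) * (RtoC (s + a)%R * E v)))
       - (A * (RtoC s * E v) + phi p / 2 * ((RtoC s * E v) * (RtoC s * E v)))))
      <= 2 * (eta * L) * (s + a - s)).
    { intros v Hv; apply (path_estimate F (fun s => RtoC s * E v)%C (fun _ => E v));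
        try lra.
      - intros u Hu; eapply pderiv_eq;
          [|apply pderiv_mult; [apply DR | apply pderiv_const]]. cbv beta. ring.
      - intros u Hu; apply ctsC_const.
      - intros u Hu; apply CF2; lra.
      - intros u Hu; apply HB; lra.
      - intros u Hu; apply Main; lra. }
    assert (E1 := EH s ltac:(lra)); assert (E2 := EH (s + a) ltac:(lra)).
    assert (E3 := EV t ltac:(lra)); assert (E4 := EV (t + b) ltac:(lra)).
    unfold nu.
    match type of E1 with Cmod ?X <= _ => set (X1 := X) in * end.
    match type of E2 with Cmod ?X <= _ => set (X2 := X) in * end.
    match type of E3 with Cmod ?X <= _ => set (X3 := X) in * end.
    match type of E4 with Cmod ?X <= _ => set (X4 := X) in * end.
    (* The values of the primitive of the affine part at the four corners cancel, so [nu] is a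
       combination of the four errors alone. *)
    match goal with |- Cmod ?X <= _ => replace X with ((X2 - X1) - (X4 - X3))%C end;
      [|unfold X1, X2, X3, X4; ring].
    assert (Tr : forall c d, Cmod (c - d) <= Cmod c + Cmod d).
    { intros c d; rewrite <- (Cmod_opp d); apply Cmod_triangle. }
    assert (T1 := Tr (X2 - X1)%C (X4 - X3)%C).
    assert (T2 := Tr X2 X1); assert (T3 := Tr X4 X3).
    assert (PE : 0 <= eta * L) by nra.
    assert (U1 : eta * L * a <= eta * L * (D * r)) by (apply Rmult_le_compat_l; lra).
    assert (U2 : eta * L * b <= eta * L * (D * r)) by (apply Rmult_le_compat_l; lra).
    apply Rle_trans with (8 * (eta * L * (D * r))); [lra|].
    replace (8 * (eta * L * (D * r))) with (e' * K * r ^ 2)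
      by (unfold eta, K; ring).
    apply Rmult_le_compat_r; [apply pow2_ge_0|].
    replace eps with (e' * (K + 1)) by (unfold e'; field; lra). nra. }
unfold nu in Z.
replace (s1 + (1 - s1))%R with 1 in Z by ring.
rewrite Rplus_0_l in Z.
replace (V T s1 1) with (V 0 s1 1) in Z by (unfold V; rewrite Hper; reflexivity).
assert (Z' : H 1 0 T = H s1 0 T).
{ replace (H 1 0 T) with (H 1 0 T - H s1 0 T - (V 0 s1 1 - V 0 s1 1) + H s1 0 T)%C by ring.
  rewrite Z; ring. }
fold (H s1 0 T); rewrite <- Z'; unfold H.
apply CInt_ext; [exact HT|]; intros t Ht.
rewrite !Cmult_1_l; reflexivity.
Qed.

(** * Cauchy's formula and its consequences *)

(* [lra] comes first because [Rmult_le_pos] would otherwise unfold [PI] as a product. *)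
Ltac nonneg := repeat first [lra | apply pow_le | apply Rmult_le_pos].

Lemma Cminus_eq_0 (a b : C) : (a - b)%C = RtoC 0 -> a = b.
Proof. intros H; replace a with (a - b + b)%C by ring; rewrite H; ring. Qed.

Definition circ (rho t : R) : C := (RtoC rho * (cos t, sin t))%C.
(** The reciprocal of [circ rho t], written through the conjugate so that it is differentiated
    without a quotient rule. *)
Definition icirc (rho t : R) : C := (RtoC (/ rho) * (cos t, - sin t)%R)%C.

Lemma Cmod_cis (t : R) : Cmod (cos t, sin t) = 1.
Proof.
unfold Cmod; simpl.
replace (cos t * (cos t * 1) + sin t * (sin t * 1)) with 1; [apply sqrt_1|].
generalize (sin2_cos2 t); unfold Rsqr; lra.
Qed.

Lemma Cmod_circ (rho t : R) : 0 < rho -> Cmod (circ rho t) = rho.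
Proof.
intros H; unfold circ; rewrite Cmod_mult, Cmod_cis, Cmod_R, Rabs_pos_eq; lra.
Qed.

Lemma circ_icirc (rho t : R) : 0 < rho -> (icirc rho t * circ rho t)%C = RtoC 1.
Proof.
intros H; unfold icirc, circ.
assert (E : ((cos t, - sin t)%R * (cos t, sin t))%C = RtoC 1).
{ unfold Cmult, RtoC; simpl; f_equal; [|ring].
  generalize (sin2_cos2 t); unfold Rsqr; lra. }
replace (RtoC (/ rho) * (cos t, - sin t)%R * (RtoC rho * (cos t, sin t)))%C
  with (RtoC (/ rho) * RtoC rho * ((cos t, - sin t)%R * (cos t, sin t)))%C by ring.
rewrite E, <- RtoC_mult, Rinv_l, Cmult_1_l; [reflexivity | lra].
Qed.

Lemma Cmod_icirc (rho t : R) : 0 < rho -> Cmod (icirc rho t) = / rho.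
Proof.
intros H; assert (E := f_equal Cmod (circ_icirc rho t H)).
rewrite Cmod_mult, Cmod_circ, Cmod_1 in E by exact H.
field_simplify_eq; [lra | lra].
Qed.

Lemma circ_neq0 (rho t : R) : 0 < rho -> circ rho t <> RtoC 0.
Proof. intros H; apply Cmod_gt_0; rewrite Cmod_circ; assumption. Qed.

Lemma pderiv_circ (rho t : R) : pderiv (circ rho) t (Ci * circ rho t)%C.
Proof.
unfold circ; eapply pderiv_eq.
2: { apply pderiv_mult; [apply pderiv_const|].
  instantiate (1 := (- sin t, cos t)); split; simpl.
  - apply is_derive_cos.
  - apply is_derive_sin. }
unfold Ci, Cmult, Cplus, RtoC; simpl; f_equal; ring.
Qed.

Lemma pderiv_icirc (rho t : R) : pderiv (icirc rho) t (- Ci * icirc rho t)%C.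
Proof.
unfold icirc; eapply pderiv_eq.
2: { apply pderiv_mult; [apply pderiv_const|].
  instantiate (1 := (- sin t, - cos t)); split; simpl.
  - apply is_derive_cos.
  - apply (is_derive_opp (V := R_NormedModule)), is_derive_sin. }
unfold Ci, Cmult, Cplus, Copp, RtoC; simpl; f_equal; ring.
Qed.

Lemma pderiv_icirc_pow (rho t : R) (k : nat) :
  pderiv (fun u => icirc rho u ^ k)%C t (RtoC (INR k) * (- Ci) * icirc rho t ^ k)%C.
Proof.
induction k as [|k IH].
- simpl; eapply pderiv_eq; [|apply pderiv_const]. simpl; ring.
- eapply pderiv_eq; [|apply (pderiv_mult _ _ _ _ _ (pderiv_icirc rho t) IH)].
  rewrite S_INR, RtoC_plus; simpl; ring.
Qed.

Lemma ctsC_circ (rho t : R) : ctsC (U := R_UniformSpace) (circ rho) t.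
Proof. eapply pderiv_ctsC, pderiv_circ. Qed.

Lemma ctsC_icirc (rho t : R) : ctsC (U := R_UniformSpace) (icirc rho) t.
Proof. eapply pderiv_ctsC, pderiv_icirc. Qed.

(** The chord is the integral of the derivative, whose modulus is [rho]; the factor [2] is that of
    [CInt_bound]. *)
Lemma circ_lipschitz (rho t u : R) : 0 < rho ->
  Cmod (circ rho t - circ rho u) <= 2 * rho * Rabs (t - u).
Proof.
intros H.
assert (K : forall a b, a <= b -> Cmod (circ rho b - circ rho a) <= 2 * rho * (b - a)).
{ intros a b Hab.
  assert (Q : ctson (fun v => Ci * circ rho v)%C a b)
    by (intros v _; apply ctsC_mult; [apply ctsC_const | apply ctsC_circ]).
  rewrite <- (CInt_FTC (circ rho) (fun v => Ci * circ rho v)%C);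
    [|exact Hab|intros; apply pderiv_circ|exact Q].
  apply CInt_bound; [exact Hab | exact Q|].
  intros v _; rewrite Cmod_mult, Cmod_Ci, Cmod_circ; lra. }
destruct (Rle_dec t u) as [L|L].
- rewrite Cmod_sym, Rabs_left1 by lra. replace (- (t - u)) with (u - t) by ring; auto.
- rewrite Rabs_pos_eq by lra; apply K; lra.
Qed.

Lemma PI2_pos : 0 < 2 * PI.
Proof. generalize PI_RGT_0; lra. Qed.

Lemma twopi_neq0 : RtoC (2 * PI) <> RtoC 0.
Proof. intros E; apply (f_equal fst) in E; simpl in E; generalize PI2_pos; lra. Qed.

Lemma geometric_le_0 (x c q : R) : 0 <= q < 1 -> (forall n, x <= c * q ^ n) -> x <= 0.
Proof.
intros Hq H.
destruct (Rle_lt_dec x 0) as [L|L]; [exact L|exfalso].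
assert (Hc : 0 < Rabs c + 1) by (generalize (Rabs_pos c); lra).
assert (E : 0 < x / (Rabs c + 1)) by (apply Rdiv_lt_0_compat; lra).
destruct (pow_lt_1_zero q) with (y := x / (Rabs c + 1)) as [n Hn];
  [rewrite Rabs_pos_eq; lra | exact E |].
specialize (Hn n (le_n n)); rewrite Rabs_pos_eq in Hn by (apply pow_le; lra).
specialize (H n).
assert (P := pow_le q n (proj1 Hq)).
apply (Rmult_lt_compat_l _ _ _ Hc) in Hn.
replace ((Rabs c + 1) * (x / (Rabs c + 1))) with x in Hn by (field; lra).
assert (A1 := Rle_abs c). nra.
Qed.

Lemma le_eps_mult (x b c : R) : 0 <= c -> (forall e, 0 < e -> x <= b + c * e) -> x <= b.
Proof.
intros Hc H; apply le_epsilon; intros e He.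
eapply Rle_trans; [apply (H (e / (c + 1))); apply Rdiv_lt_0_compat; lra|].
apply Rplus_le_compat_l.
replace e with ((c + 1) * (e / (c + 1))) at 2 by (field; lra).
apply Rmult_le_compat_r; [apply Rlt_le, Rdiv_lt_0_compat|]; lra.
Qed.

(* With [w = circ rho t], [1 / (1 - z / w) = w / (w - z)]: [taylor_rem rho hc k z] is [2 PI] times the Cauchy integral of [hc / w ^ k] at [z], and [taylor_coef] its value at [0]. *)
Definition taylor_rem (rho : R) (hc : R -> C) (k : nat) (z : C) : C :=
  CInt (fun t => hc t * icirc rho t ^ k * / (RtoC 1 - z * icirc rho t))%C 0 (2 * PI).
Definition taylor_coef (rho : R) (hc : R -> C) (k : nat) : C :=
  CInt (fun t => hc t * icirc rho t ^ k)%C 0 (2 * PI).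

Section Taylor.

Variables (rho : R) (hc : R -> C) (M : R).
Hypothesis Hrho : 0 < rho.
Hypothesis Hhc : ctson hc 0 (2 * PI).

Let twopi_ge0 : 0 <= 2 * PI.
Proof. apply Rlt_le, PI2_pos. Qed.

Lemma kernel_lower (z : C) (t : R) : 1 - Cmod z / rho <= Cmod (RtoC 1 - z * icirc rho t).
Proof.
assert (T := Cmod_le_dist (RtoC 1) (RtoC 1 - z * icirc rho t)%C).
replace (1 - (1 - z * icirc rho t))%C with (z * icirc rho t)%C in T by ring.
rewrite Cmod_1, Cmod_mult, Cmod_icirc in T by exact Hrho.
unfold Rdiv; lra.
Qed.

Lemma ratio_lt1 (z : C) : Cmod z < rho -> 0 <= Cmod z / rho < 1.
Proof.
intros Hz; split.
- apply Rdiv_le_0_compat; [apply Cmod_ge_0 | exact Hrho].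
- apply Rmult_lt_reg_r with rho; [exact Hrho|].
  replace (Cmod z / rho * rho) with (Cmod z) by (field; lra); lra.
Qed.

Lemma kernel_neq0 (z : C) (t : R) : Cmod z < rho -> (RtoC 1 - z * icirc rho t)%C <> RtoC 0.
Proof.
intros Hz; apply Cmod_gt_0.
assert (Q := kernel_lower z t); assert (Q' := ratio_lt1 z Hz); lra.
Qed.

Lemma ctson_coef (k : nat) : ctson (fun t => hc t * icirc rho t ^ k)%C 0 (2 * PI).
Proof.
intros t Ht; apply ctsC_mult; [apply Hhc, Ht|].
apply (ctsC_pow (U := R_UniformSpace)), ctsC_icirc.
Qed.

Lemma ctson_rem (k : nat) (z : C) : Cmod z < rho ->
  ctson (fun t => hc t * icirc rho t ^ k * / (RtoC 1 - z * icirc rho t))%C 0 (2 * PI).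
Proof.
intros Hz t Ht; apply ctsC_mult; [apply ctson_coef, Ht|].
apply ctsC_inv; [|apply kernel_neq0, Hz].
apply ctsC_minus; [apply ctsC_const|].
apply ctsC_mult; [apply ctsC_const | apply ctsC_icirc].
Qed.

(** This is [1 / (1 - x) = 1 + x / (1 - x)] under the integral, with [x = z * icirc rho t].
    Iterated, it produces the Taylor polynomial with [taylor_rem] as remainder. *)
Lemma taylor_step (k : nat) (z : C) : Cmod z < rho ->
  taylor_rem rho hc k z = (taylor_coef rho hc k + z * taylor_rem rho hc (S k) z)%C.
Proof.
intros Hz; unfold taylor_rem, taylor_coef.
rewrite <- CInt_scal, <- CInt_plus; auto using ctson_coef, ctson_rem.
- apply CInt_ext; [exact twopi_ge0|]; intros t Ht; simpl.
  field; apply kernel_neq0, Hz.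
- intros t Ht; apply ctsC_mult; [apply ctsC_const | apply ctson_rem; assumption].
Qed.

Lemma taylor_shift (m k : nat) (z : C) : Cmod z < rho ->
  (forall i, (m <= i < m + k)%nat -> taylor_coef rho hc i = RtoC 0) ->
  taylor_rem rho hc m z = (z ^ k * taylor_rem rho hc (m + k) z)%C.
Proof.
intros Hz; induction k as [|k IH]; intros H0.
- rewrite Nat.add_0_r; simpl; ring.
- rewrite IH by (intros; apply H0; lia).
  rewrite taylor_step, H0 by (auto; lia).
  rewrite Nat.add_succ_r; simpl; ring.
Qed.

Hypothesis HM : forall t, 0 <= t <= 2 * PI -> Cmod (hc t) <= M.

Lemma taylor_coef_bound (k : nat) :
  Cmod (taylor_coef rho hc k) <= 2 * (M * (/ rho) ^ k) * (2 * PI).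
Proof.
unfold taylor_coef.
eapply Rle_trans; [apply CInt_bound with (M := M * (/ rho) ^ k); [exact twopi_ge0|apply ctson_coef|]|
  rewrite Rminus_0_r; apply Rle_refl].
intros t Ht; rewrite Cmod_mult, Cmod_pow, Cmod_icirc by exact Hrho.
apply Rmult_le_compat_r; [apply pow_le, Rlt_le, Rinv_0_lt_compat, Hrho | auto].
Qed.

Lemma taylor_rem_bound (k : nat) (z : C) : Cmod z < rho ->
  Cmod (taylor_rem rho hc k z) <= 2 * (M * (/ rho) ^ k * / (1 - Cmod z / rho)) * (2 * PI).
Proof.
intros Hz; unfold taylor_rem.
eapply Rle_trans; [apply CInt_bound with (M := M * (/ rho) ^ k * / (1 - Cmod z / rho));
  [exact twopi_ge0|apply ctson_rem, Hz|]|rewrite Rminus_0_r; apply Rle_refl].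
intros t Ht; rewrite !Cmod_mult, Cmod_pow, Cmod_icirc by exact Hrho.
assert (P := pow_le (/ rho) k (Rlt_le _ _ (Rinv_0_lt_compat _ Hrho))).
rewrite Cmod_inv by (apply kernel_neq0, Hz).
assert (Q := ratio_lt1 z Hz).
apply Rmult_le_compat.
- apply Rmult_le_pos; [apply Cmod_ge_0 | exact P].
- apply Rlt_le, Rinv_0_lt_compat, Cmod_gt_0, kernel_neq0, Hz.
- apply Rmult_le_compat_r; auto.
- apply Rinv_le_contravar; [lra | apply kernel_lower].
Qed.

(** Each vanishing coefficient pulls out a factor [z] while the bound on the remainder gains only
    [/ rho], so the modulus is at most a constant times [(Cmod z / rho) ^ n] for every [n]. *)
Lemma taylor_all_zero (m : nat) (z : C) : Cmod z < rho ->
  (forall i, (m <= i)%nat -> taylor_coef rho hc i = RtoC 0) -> taylor_rem rho hc m z = RtoC 0.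
Proof.
intros Hz H0; apply Cmod_eq_0, Rle_antisym; [|apply Cmod_ge_0].
apply geometric_le_0 with (q := Cmod z / rho)
  (c := 2 * (M * (/ rho) ^ m * / (1 - Cmod z / rho)) * (2 * PI)); [apply ratio_lt1, Hz|].
intros n; rewrite (taylor_shift m n) by (auto; intros; apply H0; lia).
rewrite Cmod_mult, Cmod_pow.
eapply Rle_trans; [apply Rmult_le_compat_l; [apply pow_le, Cmod_ge_0 | apply taylor_rem_bound, Hz]|].
right; rewrite pow_add; unfold Rdiv; rewrite Rpow_mult_distr; ring.
Qed.

End Taylor.

(** Cauchy's formula for the constant [1]. The coefficient of index [0] is the length of the
    parameter interval; the higher ones vanish because a positive power of [icirc] has a periodic
    primitive. *)
Lemma taylor_rem_one (rho : R) (z : C) : 0 < rho -> Cmod z < rho ->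
  taylor_rem rho (fun _ => RtoC 1) 0 z = RtoC (2 * PI).
Proof.
intros Hrho Hz.
assert (P2 := PI2_pos).
assert (H1 : ctson (fun _ => RtoC 1) 0 (2 * PI)) by (intros t _; apply ctsC_const).
rewrite taylor_step by assumption.
rewrite (taylor_all_zero rho (fun _ => RtoC 1) 1) with (m := 1%nat); try assumption.
- rewrite Cmult_0_r, Cplus_0_r; unfold taylor_coef.
  rewrite (CInt_FTC RtoC).
  + rewrite <- RtoC_minus; f_equal; ring.
  + lra.
  + intros t _; split; simpl; [rewrite Rmult_1_r, Rmult_0_r, Rminus_0_r;
      apply (is_derive_id (K := R_AbsRing))|].
    replace (1 * 0 + 0 * 1) with 0 by ring; apply (is_derive_const (V := R_NormedModule)).
  + intros t _; apply ctsC_mult; apply ctsC_const.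
- intros t _; rewrite Cmod_1; lra.
- intros i Hi; unfold taylor_coef.
  assert (Ni : RtoC (INR i) <> RtoC 0).
  { intros E; apply (f_equal fst) in E; simpl in E; apply (INR_eq i 0) in E; lia. }
  assert (NC : Ci <> RtoC 0) by (intros E; apply (f_equal snd) in E; simpl in E; lra).
  rewrite (CInt_FTC (fun t => / (RtoC (INR i) * - Ci) * icirc rho t ^ i)%C).
  + replace (icirc rho (2 * PI)) with (icirc rho 0); [ring|].
    unfold icirc; rewrite cos_2PI, sin_2PI, cos_0, sin_0; reflexivity.
  + lra.
  + intros t _; eapply pderiv_eq; [|apply pderiv_mult;
      [apply pderiv_const | apply pderiv_icirc_pow]].
    cbv beta; field; split; assumption.
  + intros t _; apply ctsC_mult; [apply ctsC_const|].
    apply (ctsC_pow (U := R_UniformSpace)), ctsC_icirc.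
Qed.

(** The difference quotient at [z0] is differentiable off [z0], so the circle may be shrunk towards
    [z0] by any factor [s > 0] without changing the integral. The quotient stays bounded near [z0]
    and the length of the curve is proportional to [s], so the integral is arbitrarily small. *)
Lemma cauchy_vanishing (rho : R) (h : C -> C) (z0 : C) :
  0 < rho -> Cmod z0 < rho -> (forall z, Cmod z <= rho -> Cdif h z) ->
  CInt (fun t => (h (circ rho t) - h z0) / (circ rho t - z0) * (Ci * circ rho t))%C 0 (2 * PI)
  = RtoC 0.
Proof.
intros Hrho Hz Hh.
assert (P2 := PI2_pos).
pose (E := fun t => (circ rho t - z0)%C).
pose (F := fun w => ((h (z0 + w) - h z0) / w)%C).
assert (EN : forall t, E t <> RtoC 0).
{ intros t H; unfold E in H.
  assert (Q : circ rho t = z0) by (replace (circ rho t) with (circ rho t - z0 + z0)%C by ring;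
    rewrite H; ring).
  apply (f_equal Cmod) in Q; rewrite Cmod_circ in Q; lra. }
assert (HE : forall t, pderiv E t (Ci * circ rho t)%C).
{ intros t; eapply pderiv_eq; [|apply pderiv_plus; [apply pderiv_circ | apply pderiv_const]]. ring. }
assert (HF : forall s t, 0 < s <= 1 -> Cdif F (RtoC s * E t)%C).
{ intros s t Hs; unfold F, Cdiv.
  apply Cdif_mult.
  - apply Cdif_minus; [|apply Cdif_const].
    apply Cdif_shift, Hh; unfold E.
    (* A convex combination of [z0] and a point of the circle stays in the disc. *)
    replace (z0 + RtoC s * (circ rho t - z0))%C
      with (RtoC (1 - s)%R * z0 + RtoC s * circ rho t)%C by (rewrite RtoC_minus; ring).
    eapply Rle_trans; [apply Cmod_triangle|].
    rewrite !Cmod_mult, !Cmod_R, !Rabs_pos_eq, Cmod_circ by lra.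
    assert (0 <= (1 - s) * (rho - Cmod z0)) by (apply Rmult_le_pos; lra). lra.
  - apply Cdif_inv; [apply Cdif_id|].
    apply Cmult_neq_0; [|apply EN].
    intros Q; apply (f_equal fst) in Q; simpl in Q; lra. }
assert (G : forall s, 0 < s <= 1 ->
  CInt (fun t => F (E t) * (Ci * circ rho t))%C 0 (2 * PI) =
  CInt (fun t => F (RtoC s * E t) * (RtoC s * (Ci * circ rho t)))%C 0 (2 * PI)).
{ intros s Hs; apply (goursat_homothety F E (fun t => Ci * circ rho t)%C (2 * rho)); try lra.
  - intros t _; apply HE.
  - intros t _; apply ctsC_mult; [apply ctsC_const | apply ctsC_circ].
  - intros t _; split.
    + unfold E, Cminus; eapply Rle_trans; [apply Cmod_triangle|].
      rewrite Cmod_opp, Cmod_circ; lra.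
    + rewrite Cmod_mult, Cmod_Ci, Cmod_circ; lra.
  - intros t u _ _; unfold E.
    replace (circ rho t - z0 - (circ rho u - z0))%C with (circ rho t - circ rho u)%C by ring.
    apply circ_lipschitz, Hrho.
  - unfold E, circ; rewrite cos_2PI, sin_2PI, cos_0, sin_0; reflexivity.
  - intros u t Hu _; apply HF; lra. }
replace (CInt _ 0 (2 * PI)) with (CInt (fun t => F (E t) * (Ci * circ rho t))%C 0 (2 * PI)).
2: { apply CInt_ext; [lra|]; intros t _; unfold F, E.
  replace (z0 + (circ rho t - z0))%C with (circ rho t) by ring; reflexivity. }
destruct (Hh z0) as [phi [Cphi Kphi]]; [lra|].
destruct (proj1 (locally_Cmod z0 _) (proj1 (ctsC_eps phi z0) Cphi 1 Rlt_0_1)) as [d [Hd Q]].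
set (B := Cmod (phi z0) + 1).
assert (HB : 0 <= B) by (unfold B; generalize (Cmod_ge_0 (phi z0)); lra).
apply Cmod_eq_0, Rle_antisym; [|apply Cmod_ge_0].
apply le_eps_mult with (c := 2 * (B * rho) * (2 * PI)).
{ nonneg. }
intros e He; rewrite Rplus_0_l.
(* [s <= e] makes the integral small; [s * (4 * rho) <= d] puts the shrunk curve, which is within
   [2 * rho * s] of [z0], where [phi] is bounded by [B]. *)
set (s := Rmin (Rmin 1 e) (d / (4 * rho))).
assert (S0 : 0 < s).
{ unfold s; repeat apply Rmin_glb_lt; try lra. apply Rdiv_lt_0_compat; lra. }
assert (S1 : s <= 1) by (unfold s; eapply Rle_trans; [apply Rmin_l | apply Rmin_l]).
assert (S2 : s <= e) by (unfold s; eapply Rle_trans; [apply Rmin_l | apply Rmin_r]).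
assert (S3 : s * (4 * rho) <= d).
{ replace d with (d / (4 * rho) * (4 * rho)) by (field; lra).
  apply Rmult_le_compat_r; [lra | unfold s; apply Rmin_r]. }
rewrite (G s) by lra.
apply Rle_trans with (2 * (B * (s * rho)) * (2 * PI - 0)).
- apply CInt_bound; [lra| |].
  + intros t _; apply ctsC_mult.
    * apply (ctsC_comp F (U := R_UniformSpace) (fun t => RtoC s * E t)%C).
      -- apply ctsC_mult; [apply ctsC_const | eapply pderiv_ctsC, HE].
      -- apply Cdif_ctsC, HF; lra.
    * apply ctsC_mult; [apply ctsC_const|].
      apply ctsC_mult; [apply ctsC_const | apply ctsC_circ].
  + intros t _.
    assert (N : (RtoC s * E t)%C <> RtoC 0).
    { apply Cmult_neq_0; [|apply EN].
      intros W; apply (f_equal fst) in W; simpl in W; lra. }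
    replace (F (RtoC s * E t)%C) with (phi (z0 + RtoC s * E t)%C).
    2: { unfold F; rewrite (Kphi (z0 + RtoC s * E t)%C).
      revert N; generalize (RtoC s * E t)%C; intros w N; field; exact N. }
    rewrite !Cmod_mult, Cmod_Ci, Cmod_circ, Cmod_R, Rabs_pos_eq, Rmult_1_l by lra.
    apply Rmult_le_compat_r; [nra|].
    eapply Rle_trans; [apply (Cmod_le_dist _ (phi z0))|].
    unfold B; apply Rplus_le_compat_l, Rlt_le, Q.
    replace (z0 + RtoC s * E t - z0)%C with (RtoC s * E t)%C by ring.
    rewrite Cmod_mult, Cmod_R, Rabs_pos_eq by lra.
    assert (Cmod (E t) <= 2 * rho).
    { unfold E, Cminus; eapply Rle_trans; [apply Cmod_triangle|].
      rewrite Cmod_opp, Cmod_circ; lra. }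
    nra.
- rewrite Rminus_0_r.
  assert (0 <= 2 * (B * rho) * (2 * PI)) by (nonneg).
  nra.
Qed.

(** Cauchy's formula is made a property of its own because it passes to uniform limits, and what is
    later asked of a limit function follows from it without any differentiability of the limit. *)
Definition cauchy_rep (rho : R) (h : C -> C) : Prop :=
  ctson (fun t => h (circ rho t)) 0 (2 * PI) /\
  forall z, Cmod z < rho ->
    taylor_rem rho (fun t => h (circ rho t)) 0 z = (RtoC (2 * PI) * h z)%C.

Theorem cauchy_formula (rho : R) (h : C -> C) :
  0 < rho -> (forall z, Cmod z <= rho -> Cdif h z) -> cauchy_rep rho h.
Proof.
intros Hrho Hh.
assert (P2 := PI2_pos).
assert (Ch : ctson (fun t => h (circ rho t)) 0 (2 * PI)).
{ intros t _; apply (ctsC_comp h (U := R_UniformSpace) (circ rho)); [apply ctsC_circ|].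
  apply Cdif_ctsC, Hh; rewrite Cmod_circ; lra. }
split; [exact Ch|]; intros z0 Hz.
assert (C1 : ctson (fun _ => RtoC 1) 0 (2 * PI)) by (intros t _; apply ctsC_const).
assert (V := cauchy_vanishing rho h z0 Hrho Hz Hh).
assert (N : Ci <> RtoC 0) by (intros E; apply (f_equal snd) in E; simpl in E; lra).
(* Since [circ / (circ - z0)] is [1 / (1 - z0 * icirc)], the vanishing integral splits into the
   Cauchy integral of [h] minus [h z0] times that of [1]. *)
rewrite (CInt_ext _ (fun t => Ci * (h (circ rho t) * icirc rho t ^ 0 * / (1 - z0 * icirc rho t)
  - h z0 * (RtoC 1 * icirc rho t ^ 0 * / (1 - z0 * icirc rho t))))%C) in V; [| lra |].
2: { intros t _.
  assert (K := kernel_neq0 rho Hrho z0 t Hz).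
  assert (I := circ_icirc rho t Hrho).
  assert (D : (circ rho t - z0)%C = ((1 - z0 * icirc rho t) * circ rho t)%C).
  { replace ((1 - z0 * icirc rho t) * circ rho t)%C
      with (circ rho t - z0 * (icirc rho t * circ rho t))%C by ring.
    rewrite I; ring. }
  rewrite D; simpl; field; split; [exact K | apply circ_neq0, Hrho]. }
assert (R1 := ctson_rem rho _ Hrho Ch 0 z0 Hz).
assert (R2 := ctson_rem rho _ Hrho C1 0 z0 Hz).
assert (R3 : ctson (fun t => h z0 * (RtoC 1 * icirc rho t ^ 0 * / (1 - z0 * icirc rho t)))%C
  0 (2 * PI)) by (intros t Ht; apply ctsC_mult; [apply ctsC_const | apply R2, Ht]).
rewrite CInt_scal in V; [|lra|intros t Ht; apply ctsC_minus; [apply R1, Ht | apply R3, Ht]].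
rewrite CInt_minus in V; [|lra|exact R1|exact R3].
rewrite CInt_scal in V; [|lra|exact R2].
assert (T1 := taylor_rem_one rho z0 Hrho Hz).
unfold taylor_rem in T1 |- *; rewrite T1 in V.
match type of V with (Ci * (?X - _))%C = _ =>
  replace X with (/ Ci * (Ci * (X - h z0 * RtoC (2 * PI))) + h z0 * RtoC (2 * PI))%C
    by (field; exact N) end.
rewrite V; ring.
Qed.

Lemma uniform_limit_ctsC {U : UniformSpace} (v : nat -> U -> C) (w : U -> C) (x : U) :
  (forall n, ctsC (v n) x) ->
  (forall e, 0 < e -> exists n, forall y, Cmod (v n y - w y) <= e) -> ctsC w x.
Proof.
intros Hv Hlim; apply ctsC_eps; intros e He.
destruct (Hlim (e / 4)) as [n Hn]; [lra|].
apply filter_imp with (2 := proj1 (ctsC_eps (v n) x) (Hv n) (e / 4) ltac:(lra)).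
intros y Hy.
replace (w y - w x)%C with ((v n y - v n x) + ((v n x - w x) - (v n y - w y)))%C by ring.
assert (T1 := Cmod_triangle (v n y - v n x) ((v n x - w x) - (v n y - w y))).
assert (T2 := Cmod_triangle (v n x - w x) (- (v n y - w y))).
rewrite Cmod_opp in T2; unfold Cminus in *.
assert (A1 := Hn x); assert (A2 := Hn y); unfold Cminus in A1, A2; lra.
Qed.

(** For fixed [z] inside the circle both sides of the formula are linear in the function and bounded
    by a multiple of its supremum on the closed disc. *)
Lemma cauchy_rep_limit (rho : R) (u : nat -> C -> C) (h : C -> C) :
  0 < rho -> (forall n, cauchy_rep rho (u n)) ->
  (forall e, 0 < e -> exists N, forall n, (N <= n)%nat -> forall z, Cmod z <= rho ->
     Cmod (u n z - h z) <= e) ->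
  cauchy_rep rho h.
Proof.
intros Hrho Hu Hlim.
assert (P2 := PI2_pos).
assert (Ch : ctson (fun t => h (circ rho t)) 0 (2 * PI)).
{ intros t Ht.
  apply (uniform_limit_ctsC (U := R_UniformSpace) (fun n t => u n (circ rho t))).
  - intros n; apply (Hu n), Ht.
  - intros e He; destruct (Hlim e He) as [N HN]; exists N; intros y.
    apply (HN N (le_n N)); rewrite Cmod_circ; lra. }
split; [exact Ch|]; intros z Hz.
assert (Q := ratio_lt1 rho Hrho z Hz).
assert (QI : 0 < / (1 - Cmod z / rho)) by (apply Rinv_0_lt_compat; lra).
apply Cminus_eq_0, Cmod_eq_0, Rle_antisym; [|apply Cmod_ge_0].
apply le_eps_mult with (c := 2 * / (1 - Cmod z / rho) * (2 * PI) + 2 * PI).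
{ assert (0 <= 2 * / (1 - Cmod z / rho) * (2 * PI)) by (nonneg). lra. }
intros e He; destruct (Hlim e He) as [N HN].
specialize (HN N (le_n N)).
destruct (Hu N) as [Cu Fu]; specialize (Fu z Hz).
pose (D := fun t => (u N (circ rho t) - h (circ rho t))%C).
assert (CD : ctson D 0 (2 * PI)) by (intros t Ht; apply ctsC_minus; [apply Cu, Ht | apply Ch, Ht]).
assert (ED : taylor_rem rho D 0 z = (taylor_rem rho (fun t => u N (circ rho t)) 0 z
  - taylor_rem rho (fun t => h (circ rho t)) 0 z)%C).
{ unfold taylor_rem; rewrite <- CInt_minus; try lra; try (apply ctson_rem; assumption).
  apply CInt_ext; [lra|]; intros t _; unfold D; ring. }
assert (BD := taylor_rem_bound rho D e Hrho CD
  (fun t _ => HN _ (Req_le _ _ (Cmod_circ rho t Hrho))) 0 z Hz).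
rewrite ED, Fu in BD; simpl in BD; rewrite Rmult_1_r in BD.
replace (taylor_rem rho (fun t => h (circ rho t)) 0 z - RtoC (2 * PI) * h z)%C
  with (RtoC (2 * PI) * (u N z - h z) - (RtoC (2 * PI) * u N z
    - taylor_rem rho (fun t => h (circ rho t)) 0 z))%C by ring.
unfold Cminus at 1; eapply Rle_trans; [apply Cmod_triangle|].
rewrite Cmod_opp, Cmod_mult, Cmod_R, Rabs_pos_eq by lra.
assert (B2 := HN z (Rlt_le _ _ Hz)).
assert (2 * PI * Cmod (u N z - h z) <= 2 * PI * e) by (apply Rmult_le_compat_l; lra).
lra.
Qed.

(** If [a] is the first nonzero coefficient and [k] its index, then [2 * PI * h z] is [z ^ k] times
    [a + z * R] with [R] bounded near [0]. This is the quantitative isolation of a zero; the lower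
    bound on small circles is also what Hurwitz's argument needs. *)
Lemma zero_or_power_lower_bound (rho M : R) (h : C -> C) :
  0 < rho -> cauchy_rep rho h -> (forall z, Cmod z <= rho -> Cmod (h z) <= M) ->
  (forall z, Cmod z < rho -> h z = RtoC 0) \/
  exists k c r, 0 < c /\ 0 < r < rho /\ forall z, Cmod z <= r -> c * Cmod z ^ k <= Cmod (h z).
Proof.
intros Hrho [Ch Fh] HM.
assert (P2 := PI2_pos).
set (hc := fun t => h (circ rho t)) in *.
assert (HMc : forall t, 0 <= t <= 2 * PI -> Cmod (hc t) <= M).
{ intros t _; apply HM; rewrite Cmod_circ; lra. }
destruct (classic (forall i, taylor_coef rho hc i = RtoC 0)) as [Z|NZ].
- left; intros z Hz.
  assert (E := taylor_all_zero rho hc M Hrho Ch HMc 0 z Hz (fun i _ => Z i)).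
  rewrite Fh in E by exact Hz.
  replace (h z) with (/ RtoC (2 * PI) * (RtoC (2 * PI) * h z))%C by (field; apply twopi_neq0).
  rewrite E; ring.
- right.
  assert (LE : exists k, taylor_coef rho hc k <> RtoC 0 /\
    forall i, (i < k)%nat -> taylor_coef rho hc i = RtoC 0).
  { apply not_all_ex_not in NZ; destruct NZ as [k Hk]; revert Hk.
    induction k as [k IH] using (well_founded_induction Wf_nat.lt_wf); intros Hk.
    destruct (classic (forall i, (i < k)%nat -> taylor_coef rho hc i = RtoC 0)) as [L|L].
    - exists k; auto.
    - apply not_all_ex_not in L; destruct L as [i L].
      apply imply_to_and in L; destruct L as [L1 L2]; exact (IH i L1 L2). }
  destruct LE as [k [Hk Hlt]].
  set (a := taylor_coef rho hc k) in *.
  assert (Ha : 0 < Cmod a) by (apply Cmod_gt_0, Hk).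
  assert (HM0 : 0 <= M).
  { eapply Rle_trans; [apply Cmod_ge_0 | apply (HM (RtoC 0)); rewrite Cmod_0; lra]. }
  set (B := 2 * (M * (/ rho) ^ S k * 2) * (2 * PI)).
  assert (HB : 0 <= B).
  { unfold B; assert (0 <= (/ rho) ^ S k) by (apply pow_le, Rlt_le, Rinv_0_lt_compat, Hrho).
    nonneg. }
  (* [rho / 2] keeps the kernel factor [/ (1 - Cmod z / rho)] at most [2], as [B] presumes; the
     other term gives [r * B <= Cmod a / 2]. *)
  set (r := Rmin (rho / 2) (Cmod a / (2 * (B + 1)))).
  assert (R1 : r <= rho / 2) by apply Rmin_l.
  assert (R2 : r * (2 * (B + 1)) <= Cmod a).
  { replace (Cmod a) with (Cmod a / (2 * (B + 1)) * (2 * (B + 1))) by (field; lra).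
    apply Rmult_le_compat_r; [lra | apply Rmin_r]. }
  assert (R0 : 0 < r) by (apply Rmin_glb_lt; [lra | apply Rdiv_lt_0_compat; lra]).
  exists k, (Cmod a / 2 / (2 * PI)), r; split; [apply Rdiv_lt_0_compat; lra|].
  split; [lra|]; intros z Hz.
  assert (Hz' : Cmod z < rho) by lra.
  assert (E := Fh z Hz').
  rewrite (taylor_shift rho hc Hrho Ch 0 k) in E by (auto; intros; apply Hlt; lia).
  rewrite taylor_step in E by assumption; simpl Nat.add in E; fold a in E.
  assert (BR := taylor_rem_bound rho hc M Hrho Ch HMc (S k) z Hz').
  assert (BB : Cmod (taylor_rem rho hc (S k) z) <= B).
  { eapply Rle_trans; [exact BR|]; unfold B.
    apply Rmult_le_compat_r; [lra|]; apply Rmult_le_compat_l; [lra|].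
    apply Rmult_le_compat_l.
    - apply Rmult_le_pos; [exact HM0 | apply pow_le, Rlt_le, Rinv_0_lt_compat, Hrho].
    - replace 2 with (/ / 2) by field. apply Rinv_le_contravar; [lra|].
      assert (Cmod z / rho <= / 2); [|lra].
      apply Rmult_le_reg_r with rho; [exact Hrho|].
      replace (Cmod z / rho * rho) with (Cmod z) by (field; lra); lra. }
  apply (f_equal Cmod) in E; rewrite !Cmod_mult, Cmod_pow, Cmod_R, Rabs_pos_eq in E by lra.
  assert (T := Cmod_le_dist a (a + z * taylor_rem rho hc (S k) z)).
  replace (a - (a + z * taylor_rem rho hc (S k) z))%C
    with (- (z * taylor_rem rho hc (S k) z))%C in T by ring.
  rewrite Cmod_opp, Cmod_mult in T.
  assert (Y : Cmod z * Cmod (taylor_rem rho hc (S k) z) <= r * B)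
    by (apply Rmult_le_compat; auto using Cmod_ge_0).
  assert (Y2 : Cmod a / 2 <= Cmod (a + z * taylor_rem rho hc (S k) z)) by nra.
  replace (Cmod (h z)) with (/ (2 * PI) * (2 * PI * Cmod (h z))) by (field; generalize PI_RGT_0; lra).
  rewrite <- E.
  replace (Cmod a / 2 / (2 * PI) * Cmod z ^ k)
    with (/ (2 * PI) * (Cmod z ^ k * (Cmod a / 2))) by (field; generalize PI_RGT_0; lra).
  apply Rmult_le_compat_l; [apply Rlt_le, Rinv_0_lt_compat, P2|].
  apply Rmult_le_compat_l; [apply pow_le, Cmod_ge_0 | exact Y2].
Qed.

(* If [h] were not identically zero it would be bounded below on a small circle, and the mean value property of [1 / u n] there would keep [u n 0] away from [h 0 = 0]. *)
Lemma hurwitz (rho M : R) (u : nat -> C -> C) (h : C -> C) :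
  0 < rho -> (forall n z, Cmod z <= rho -> Cdif (u n) z) ->
  (forall e, 0 < e -> exists N, forall n, (N <= n)%nat -> forall z, Cmod z <= rho ->
     Cmod (u n z - h z) <= e) ->
  (forall z, Cmod z <= rho -> Cmod (h z) <= M) ->
  (forall n z, Cmod z <= rho -> u n z <> RtoC 0) -> h (RtoC 0) = RtoC 0 ->
  forall z, Cmod z < rho -> h z = RtoC 0.
Proof.
intros Hrho Hu Hlim HM Hnz H0.
assert (P2 := PI2_pos).
assert (CR : cauchy_rep rho h).
{ apply cauchy_rep_limit with u; auto; intros n; apply cauchy_formula; auto. }
destruct (zero_or_power_lower_bound rho M h Hrho CR HM) as [Z|[k [c [r [Hc [Hr L]]]]]];
  [exact Z | exfalso].
set (m := c * r ^ k).
assert (Hm : 0 < m) by (apply Rmult_lt_0_compat; [exact Hc | apply pow_lt; lra]).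
(* On the circle of radius [r] this leaves [u N] at least [m / 2] in modulus, so the mean value of
   [/ u N] gives at most [4 / m] at the centre, the factor [2] of [CInt_bound] included. But [u N 0]
   is within [m / 8] of [0], so its inverse has modulus at least [8 / m]. *)
destruct (Hlim (m / 8)) as [N HN]; [lra|].
specialize (HN N (le_n N)).
assert (D : forall z, Cmod z <= r -> Cdif (fun y => / u N y)%C z).
{ intros z Hz; apply Cdif_inv; [apply Hu | apply Hnz]; lra. }
destruct (cauchy_formula r _ (proj1 Hr) D) as [Cc Fc].
specialize (Fc (RtoC 0)); rewrite Cmod_0 in Fc; specialize (Fc (proj1 Hr)).
assert (BD : forall t, 0 <= t <= 2 * PI -> Cmod (/ u N (circ r t)) <= 2 / m).
{ intros t _.
  assert (Q : Cmod (circ r t) = r) by (apply Cmod_circ; lra).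
  rewrite Cmod_inv by (apply Hnz; lra).
  replace (2 / m) with (/ (m / 2)) by (field; lra).
  apply Rinv_le_contravar; [lra|].
  assert (A1 := L (circ r t) (Req_le _ _ Q)); rewrite Q in A1; fold m in A1.
  assert (A2 := HN (circ r t) ltac:(lra)).
  assert (A3 := Cmod_le_dist (h (circ r t)) (u N (circ r t))).
  rewrite Cmod_sym in A2; lra. }
assert (B := taylor_rem_bound r _ (2 / m) (proj1 Hr) Cc BD 0 (RtoC 0)
  ltac:(rewrite Cmod_0; lra)).
rewrite Fc, Cmod_mult, Cmod_R, Rabs_pos_eq, Cmod_0 in B by lra.
assert (N0 : u N (RtoC 0) <> RtoC 0) by (apply Hnz; rewrite Cmod_0; lra).
replace (2 * (2 / m * (/ r) ^ 0 * / (1 - 0 / r)) * (2 * PI)) with (2 * PI * (4 / m)) in B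
  by (simpl; field; lra).
apply Rmult_le_reg_l in B; [|exact P2].
rewrite Cmod_inv in B by exact N0.
assert (P : 0 < Cmod (u N (RtoC 0))) by (apply Cmod_gt_0, N0).
assert (S : Cmod (u N (RtoC 0)) <= m / 8).
{ assert (A := HN (RtoC 0) ltac:(rewrite Cmod_0; lra)); rewrite H0 in A.
  replace (u N 0 - 0)%C with (u N (RtoC 0)) in A by ring; exact A. }
apply Rinv_le_contravar in S; [|exact P].
replace (/ (m / 8)) with (4 / m + 4 / m) in S by (field; lra).
assert (0 < 4 / m) by (apply Rdiv_lt_0_compat; lra).
lra.
Qed.

(** Here [phi 0] is the derivative at [0]. Two Taylor steps at a small real [x] give
    [2 * PI * phi x] as the coefficient of index [1] plus [x] times a bounded remainder, and
    continuity of [phi] carries the bound to [0]. *)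
Lemma cauchy_estimate (rho M : R) (u phi : C -> C) :
  0 < rho -> (forall z, Cmod z <= rho -> Cdif u z) ->
  (forall z, Cmod z <= rho -> Cmod (u z) <= M) ->
  ctsC (U := C_UniformSpace) phi (RtoC 0) ->
  (forall y, u y = (u (RtoC 0) + phi y * y)%C) ->
  Cmod (phi (RtoC 0)) <= 2 * M / rho.
Proof.
intros Hrho Hu HM Cphi Kphi.
assert (P2 := PI2_pos).
destruct (cauchy_formula rho u Hrho Hu) as [Cc Fc].
set (hc := fun t => u (circ rho t)) in *.
assert (HMc : forall t, 0 <= t <= 2 * PI -> Cmod (hc t) <= M).
{ intros t _; apply HM; rewrite Cmod_circ; lra. }
assert (HM0 : 0 <= M).
{ eapply Rle_trans; [apply Cmod_ge_0 | apply (HM (RtoC 0)); rewrite Cmod_0; lra]. }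
assert (Hi : 0 < / rho) by (apply Rinv_0_lt_compat, Hrho).
set (B := 2 * (M * (/ rho) ^ 2 * 2)).
assert (HB : 0 <= B) by (unfold B; nonneg).
apply le_eps_mult with (c := 1 + B); [lra|]; intros e He.
destruct (proj1 (locally_Cmod (RtoC 0) _) (proj1 (ctsC_eps phi _) Cphi e He)) as [d [Hd Q]].
(* The three terms serve, in order, the remainder of size [B * x], the continuity of [phi], and the
   kernel factor [2] in [B]. *)
set (x := Rmin (Rmin e (d / 2)) (rho / 2)).
assert (X0 : 0 < x) by (unfold x; repeat apply Rmin_glb_lt; lra).
assert (X1 : x <= e) by (unfold x; eapply Rle_trans; [apply Rmin_l | apply Rmin_l]).
assert (X2 : x <= d / 2) by (unfold x; eapply Rle_trans; [apply Rmin_l | apply Rmin_r]).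
assert (X3 : x <= rho / 2) by (unfold x; apply Rmin_r).
assert (Nx : Cmod (RtoC x) = x) by (rewrite Cmod_R, Rabs_pos_eq; lra).
assert (Hx : Cmod (RtoC x) < rho) by lra.
assert (E0 := Fc (RtoC 0) ltac:(rewrite Cmod_0; lra)).
assert (E1 := Fc (RtoC x) Hx).
rewrite taylor_step in E0 by (auto; rewrite Cmod_0; lra).
rewrite taylor_step, taylor_step in E1 by auto.
rewrite (Kphi (RtoC x)) in E1.
assert (Nx0 : RtoC x <> RtoC 0) by (intros W; apply (f_equal fst) in W; simpl in W; lra).
assert (E : (RtoC (2 * PI) * phi (RtoC x))%C
  = (taylor_coef rho hc 1 + RtoC x * taylor_rem rho hc 2 (RtoC x))%C).
{ replace (RtoC (2 * PI) * phi (RtoC x))%C with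
    (/ RtoC x * (RtoC (2 * PI) * (u (RtoC 0) + phi (RtoC x) * RtoC x)
      - RtoC (2 * PI) * u (RtoC 0)))%C by (field; exact Nx0).
  rewrite <- E1, <- E0; field; exact Nx0. }
apply (f_equal Cmod) in E.
rewrite Cmod_mult, Cmod_R, Rabs_pos_eq in E by lra.
assert (T := Cmod_triangle (taylor_coef rho hc 1) (RtoC x * taylor_rem rho hc 2 (RtoC x))).
rewrite Cmod_mult, Nx in T.
assert (B1 := taylor_coef_bound rho hc M Hrho Cc HMc 1).
assert (B2 := taylor_rem_bound rho hc M Hrho Cc HMc 2 (RtoC x) Hx).
assert (B3 : Cmod (taylor_rem rho hc 2 (RtoC x)) <= B * (2 * PI)).
{ eapply Rle_trans; [exact B2|]; unfold B; rewrite Nx.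
  apply Rmult_le_compat_r; [lra|]; apply Rmult_le_compat_l; [lra|].
  apply Rmult_le_compat_l; [apply Rmult_le_pos; [exact HM0 | apply pow_le; lra]|].
  replace 2 with (/ / 2) by field. apply Rinv_le_contravar; [lra|].
  assert (x / rho <= / 2); [|lra].
  apply Rmult_le_reg_r with rho; [exact Hrho|].
  replace (x / rho * rho) with x by (field; lra); lra. }
assert (B4 : x * Cmod (taylor_rem rho hc 2 (RtoC x)) <= e * (B * (2 * PI)))
  by (apply Rmult_le_compat; auto using Cmod_ge_0; lra).
assert (B5 : Cmod (phi (RtoC x)) <= 2 * M / rho + B * e).
{ apply Rmult_le_reg_l with (2 * PI); [exact P2|].
  replace (2 * PI * (2 * M / rho + B * e))
    with (2 * (M * (/ rho) ^ 1) * (2 * PI) + e * (B * (2 * PI))) by (simpl; field; lra).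
  lra. }
assert (B6 := Q (RtoC x)).
replace (RtoC x - 0)%C with (RtoC x) in B6 by ring.
specialize (B6 ltac:(lra)).
assert (B7 := Cmod_le_dist (phi (RtoC 0)) (phi (RtoC x))).
rewrite Cmod_sym in B7; lra.
Qed.

(** * Functions to the Riemann sphere *)

Lemma Cminus_0_r (w : C) : (w - RtoC 0)%C = w.
Proof. ring. Qed.

Lemma Cnorm2_Cmod (z : Cx) : Cnorm2 z = Cmod z ^ 2.
Proof.
unfold Cmod, Cnorm2; rewrite pow2_sqrt; [ring|].
apply Rplus_le_le_0_compat; apply pow2_ge_0.
Qed.

Lemma Cnorm_Cmod (z : Cx) : Cnorm z = Cmod z.
Proof. unfold Cnorm; rewrite Cnorm2_Cmod; apply sqrt_pow2, Cmod_ge_0. Qed.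

Lemma Cinv_Complex (z : Cx) : Cinv z = (/ (z : C))%C.
Proof.
unfold Cinv, Complex.Cinv, Cnorm2.
replace (fst z * fst z + snd z * snd z) with (fst z ^ 2 + snd z ^ 2) by ring; reflexivity.
Qed.

(* Stereographic coordinates: [rhoS] is the Euclidean distance of the images on the unit sphere. *)
Definition stereo1 (u : Chat) : R :=
  match u with Some z => 2 * fst z / (1 + Cnorm2 z) | None => 0 end.
Definition stereo2 (u : Chat) : R :=
  match u with Some z => 2 * snd z / (1 + Cnorm2 z) | None => 0 end.
Definition stereo3 (u : Chat) : R :=
  match u with Some z => (Cnorm2 z - 1) / (1 + Cnorm2 z) | None => 1 end.

Lemma Cnorm2_ge_0 (z : Cx) : 0 <= Cnorm2 z.
Proof. unfold Cnorm2; nra. Qed.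

Lemma rhoS_ge_0 (u v : Chat) : 0 <= rhoS u v.
Proof.
assert (I : forall x, 0 < x -> 0 < sqrt x) by (intros; apply sqrt_lt_R0; assumption).
destruct u as [z|]; destruct v as [w|]; simpl; try lra;
  try assert (A := Cnorm2_ge_0 z); try assert (B := Cnorm2_ge_0 w);
  apply Rdiv_le_0_compat; try lra; try (apply I; nra).
rewrite Cnorm_Cmod; generalize (Cmod_ge_0 (Csub z w)); lra.
Qed.

Lemma rhoS_stereo (u v : Chat) : rhoS u v =
  sqrt ((stereo1 u - stereo1 v) ^ 2 + (stereo2 u - stereo2 v) ^ 2 + (stereo3 u - stereo3 v) ^ 2).
Proof.
rewrite <- (sqrt_pow2 (rhoS u v)) by apply rhoS_ge_0; f_equal.
destruct u as [z|]; destruct v as [w|]; simpl rhoS; unfold stereo1, stereo2, stereo3;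
  try assert (A := Cnorm2_ge_0 z); try assert (B := Cnorm2_ge_0 w).
- unfold Rdiv at 1; rewrite !Rpow_mult_distr, pow_inv, pow2_sqrt by nra.
  unfold Cnorm; rewrite pow2_sqrt by apply Cnorm2_ge_0.
  unfold Csub, Cnorm2 in *; simpl in *; field; nra.
- unfold Rdiv at 1; rewrite !Rpow_mult_distr, pow_inv, pow2_sqrt by nra.
  unfold Cnorm2 in *; field; nra.
- unfold Rdiv at 1; rewrite !Rpow_mult_distr, pow_inv, pow2_sqrt by nra.
  unfold Cnorm2 in *; field; nra.
- ring.
Qed.

Lemma minkowski3 (a b c x y z : R) :
  sqrt ((a + x) ^ 2 + (b + y) ^ 2 + (c + z) ^ 2) <=
  sqrt (a ^ 2 + b ^ 2 + c ^ 2) + sqrt (x ^ 2 + y ^ 2 + z ^ 2).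
Proof.
set (p := sqrt (a ^ 2 + b ^ 2 + c ^ 2)); set (q := sqrt (x ^ 2 + y ^ 2 + z ^ 2)).
assert (Hp : 0 <= p) by apply sqrt_pos; assert (Hq : 0 <= q) by apply sqrt_pos.
assert (Ep : p ^ 2 = a ^ 2 + b ^ 2 + c ^ 2) by (apply pow2_sqrt; nra).
assert (Eq : q ^ 2 = x ^ 2 + y ^ 2 + z ^ 2) by (apply pow2_sqrt; nra).
rewrite <- (sqrt_pow2 (p + q)) by lra; apply sqrt_le_1_alt.
assert (CS : a * x + b * y + c * z <= p * q).
{ apply Rle_trans with (Rabs (a * x + b * y + c * z)); [apply Rle_abs|].
  rewrite <- (Rabs_pos_eq (p * q)) by nra.
  apply Rsqr_le_abs_0; unfold Rsqr.
  replace (p * q * (p * q)) with (p ^ 2 * q ^ 2) by ring; rewrite Ep, Eq.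
  assert (S1 := pow2_ge_0 (a * y - b * x)).
  assert (S2 := pow2_ge_0 (a * z - c * x)).
  assert (S3 := pow2_ge_0 (b * z - c * y)). nra. }
nra.
Qed.

Lemma rhoS_triangle (u v w : Chat) : rhoS u w <= rhoS u v + rhoS v w.
Proof.
rewrite !rhoS_stereo.
eapply Rle_trans; [|apply minkowski3].
right; f_equal; ring.
Qed.

Lemma rhoS_sym (u v : Chat) : rhoS u v = rhoS v u.
Proof. rewrite !rhoS_stereo; f_equal; ring. Qed.

Lemma rhoS_lipschitz (a b : C) : rhoS (Some a) (Some b) <= 2 * Cmod (a - b).
Proof.
simpl; rewrite Cnorm_Cmod; change (Csub a b) with (a - b)%C.
assert (P := Cmod_ge_0 (a - b)).
assert (A := Cnorm2_ge_0 a); assert (B := Cnorm2_ge_0 b).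
assert (S : 1 <= sqrt ((1 + Cnorm2 a) * (1 + Cnorm2 b)))
  by (rewrite <- sqrt_1 at 1; apply sqrt_le_1_alt; nra).
apply Rmult_le_reg_r with (sqrt ((1 + Cnorm2 a) * (1 + Cnorm2 b))); [lra|].
unfold Rdiv; rewrite Rmult_assoc, Rinv_l by lra; nra.
Qed.

(** On the closed unit disc the denominator of [rhoS] is at most [2]. Together with [rhoS_lipschitz]
    this makes the two metrics equivalent there. *)
Lemma dist_le_rhoS (a b : C) : Cmod a <= 1 -> Cmod b <= 1 ->
  Cmod (a - b) <= rhoS (Some a) (Some b).
Proof.
intros Ha Hb; simpl; rewrite Cnorm_Cmod; change (Csub a b) with (a - b)%C.
assert (P := Cmod_ge_0 (a - b)).
assert (A := Cmod_ge_0 a); assert (B := Cmod_ge_0 b).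
rewrite !Cnorm2_Cmod.
assert (S : sqrt ((1 + Cmod a ^ 2) * (1 + Cmod b ^ 2)) <= 2).
{ rewrite <- (sqrt_pow2 2) by lra; apply sqrt_le_1_alt.
  assert (Cmod a ^ 2 <= 1) by nra; assert (Cmod b ^ 2 <= 1) by nra; nra. }
assert (S0 : 0 < sqrt ((1 + Cmod a ^ 2) * (1 + Cmod b ^ 2))) by (apply sqrt_lt_R0; nra).
apply Rmult_le_reg_r with (sqrt ((1 + Cmod a ^ 2) * (1 + Cmod b ^ 2))); [lra|].
unfold Rdiv; rewrite Rmult_assoc, Rinv_l by lra; nra.
Qed.

(** Points outside the closed unit disc, infinity included, are at chordal distance more than
    [sqrt 2] from [0]. The conclusion is the hypothesis of [dist_le_rhoS]. *)
Lemma near_zero_finite (u : Chat) : rhoS u (Some C0) < 1 ->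
  exists w : C, u = Some w /\ Cmod w <= 1.
Proof.
intros H; destruct u as [w|].
- exists w; split; [reflexivity|].
  unfold rhoS in H; rewrite Cnorm_Cmod in H.
  replace (Csub w C0) with (w : C) in H
    by (unfold Csub, C0; apply injective_projections; simpl; ring).
  replace (Cnorm2 C0) with 0 in H by (unfold Cnorm2, C0; simpl; ring).
  rewrite Cnorm2_Cmod in H.
  destruct (Rle_lt_dec (Cmod w) 1) as [L|L]; [exact L|exfalso].
  replace ((1 + Cmod w ^ 2) * (1 + 0)) with (1 + Cmod w ^ 2) in H by ring.
  assert (S0 : 0 < sqrt (1 + Cmod w ^ 2)) by (apply sqrt_lt_R0; nra).
  apply (Rmult_lt_compat_r _ _ _ S0) in H.
  unfold Rdiv in H; rewrite Rmult_assoc, Rinv_l in H by lra.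
  assert (S1 : sqrt (1 + Cmod w ^ 2) <= 2 * Cmod w).
  { rewrite <- (sqrt_pow2 (2 * Cmod w)) by lra; apply sqrt_le_1_alt; nra. }
  lra.
- exfalso; simpl in H.
  replace (1 + Cnorm2 C0) with 1 in H by (unfold Cnorm2, C0; simpl; ring).
  rewrite sqrt_1 in H; lra.
Qed.

(** Giving infinity the value [0] agrees with the convention [/ 0 = 0], so [val_recip] holds at
    zeros and poles as well. *)
Definition val (u : Chat) : C := match u with Some w => w | None => RtoC 0 end.

Lemma recip_Some (f : Cx -> Chat) (z : Cx) (w : C) :
  f z = Some w -> w <> RtoC 0 -> recip f z = Some (/ w)%C.
Proof.
intros E N; unfold recip; rewrite E.
destruct (Req_EM_T (Cnorm2 w) 0) as [Q|Q].
- exfalso; apply N; apply Cmod_eq_0; rewrite Cnorm2_Cmod in Q.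
  destruct (Req_dec (Cmod w) 0) as [D|D]; [exact D|].
  exfalso; apply (pow_nonzero _ 2 D Q).
- now rewrite Cinv_Complex.
Qed.

Lemma recip_zero (f : Cx -> Chat) (z : Cx) : f z = Some C0 -> recip f z = None.
Proof.
intros E; unfold recip; rewrite E.
destruct (Req_EM_T (Cnorm2 C0) 0) as [Q|Q]; [reflexivity|].
exfalso; apply Q; unfold Cnorm2, C0; simpl; ring.
Qed.

Lemma recip_pole (f : Cx -> Chat) (z : Cx) : f z = None -> recip f z = Some C0.
Proof. intros E; unfold recip; now rewrite E. Qed.

Lemma Cinv_0 : (/ RtoC 0)%C = RtoC 0.
Proof. unfold Complex.Cinv, RtoC; simpl; f_equal; unfold Rdiv; ring. Qed.

Lemma Cinv_neq0 (w : C) : w <> RtoC 0 -> (/ w)%C <> RtoC 0.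
Proof.
intros N; apply Cmod_gt_0; rewrite Cmod_inv by exact N.
apply Rinv_0_lt_compat, Cmod_gt_0, N.
Qed.

Lemma Chat_cases (u : Chat) : u = None \/ u = Some C0 \/ exists w : C, u = Some w /\ w <> RtoC 0.
Proof.
destruct u as [w|]; [right|now left].
destruct (classic ((w : C) = RtoC 0)) as [->|N]; [now left | right; now exists w].
Qed.

Lemma val_recip (f : Cx -> Chat) (z : Cx) : val (recip f z) = (/ val (f z))%C.
Proof.
destruct (Chat_cases (f z)) as [E|[E|[w [E N]]]].
- rewrite recip_pole, E by exact E; symmetry; apply Cinv_0.
- rewrite recip_zero, E by exact E; symmetry; apply Cinv_0.
- rewrite (recip_Some f z w), E by assumption; reflexivity.
Qed.

Lemma recip_recip (f : Cx -> Chat) (z : Cx) : recip (recip f) z = f z.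
Proof.
destruct (Chat_cases (f z)) as [E|[E|[w [E N]]]]; rewrite E.
- apply recip_zero, recip_pole, E.
- apply recip_pole, recip_zero, E.
- rewrite (recip_Some _ _ (/ w)%C); [f_equal; field; exact N
    | apply recip_Some; assumption | apply Cinv_neq0, N].
Qed.

(** Inversion is the half-turn of the unit sphere about its first axis: it negates the second and
    third stereographic coordinates. *)
Lemma rhoS_recip (f g : Cx -> Chat) (x y : Cx) : rhoS (recip f x) (recip g y) = rhoS (f x) (g y).
Proof.
assert (K : forall h z, stereo1 (recip h z) = stereo1 (h z) /\
  stereo2 (recip h z) = - stereo2 (h z) /\ stereo3 (recip h z) = - stereo3 (h z)).
{ intros h z; destruct (Chat_cases (h z)) as [E|[E|[w [E N]]]].
  - rewrite recip_pole, E by exact E; unfold stereo1, stereo2, stereo3, Cnorm2, C0; simpl.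
    repeat split; field.
  - rewrite recip_zero, E by exact E; unfold stereo1, stereo2, stereo3, Cnorm2, C0; simpl.
    repeat split; field.
  - rewrite (recip_Some h z w), E by assumption.
    assert (P : 0 < fst w ^ 2 + snd w ^ 2).
    { apply Cmod_gt_0 in N; assert (Q := Cnorm2_Cmod w); unfold Cnorm2 in Q; nra. }
    unfold stereo1, stereo2, stereo3, Cnorm2, Complex.Cinv; simpl in *.
    repeat split; field; repeat split; nra. }
destruct (K f x) as [A1 [A2 A3]]; destruct (K g y) as [B1 [B2 B3]].
rewrite !rhoS_stereo, A1, A2, A3, B1, B2, B3; f_equal; ring.
Qed.

(** Finiteness near [z] is demanded separately because [val] disguises poles as zeros. *)
Definition sdiff (f : Cx -> Chat) (z : C) : Prop :=
  locally (T := C_UniformSpace) z (fun y => f y <> None) /\ Cdif (fun y => val (f y)) z.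

(* Holomorphic as a map to the sphere; unlike [meromorphic] this is symmetric under [recip]. *)
Definition sphere_holo (f : Cx -> Chat) : Prop := forall z, sdiff f z \/ sdiff (recip f) z.

Lemma sdiff_ext (f g : Cx -> Chat) (z : C) : (forall y, f y = g y) -> sdiff f z -> sdiff g z.
Proof.
intros E [A B]; split.
- apply filter_imp with (2 := A); intros y; now rewrite E.
- apply Cdif_ext with (2 := B); intros y; now rewrite E.
Qed.

Lemma sdiff_recip (f : Cx -> Chat) (z : C) : sdiff f z -> f z <> Some C0 -> sdiff (recip f) z.
Proof.
intros [A B] N.
assert (V : val (f z) <> RtoC 0).
{ assert (K := locally_singleton _ _ A); cbv beta in K; intros Q.
  destruct (f z) as [w|]; [apply N; simpl in Q; rewrite Q; reflexivity | now apply K]. }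
split.
- assert (Q := proj1 (ctsC_eps _ z) (Cdif_ctsC _ _ B) (Cmod (val (f z)))
    (proj1 (Cmod_gt_0 _) V)).
  apply filter_imp with (2 := filter_and _ _ A Q); intros y [F1 F2] R.
  destruct (Chat_cases (f y)) as [E|[E|[w [E NW]]]].
  + contradiction.
  + rewrite E in F2; simpl in F2; rewrite Cmod_sym in F2.
    replace (val (f z) - C0)%C with (val (f z)) in F2; [lra|].
    change C0 with (RtoC 0); ring.
  + rewrite (recip_Some f y w) in R by assumption; discriminate.
- apply Cdif_ext with (fun y => / val (f y))%C.
  + intros y; symmetry; apply val_recip.
  + apply Cdif_inv; assumption.
Qed.

Lemma sphere_holo_finite (f : Cx -> Chat) (z : C) : sphere_holo f -> f z <> None -> sdiff f z.
Proof.
intros H N; destruct (H z) as [A|A]; [exact A|].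
apply sdiff_ext with (recip (recip f)); [apply recip_recip|].
apply sdiff_recip; [exact A|]; intros E; apply N.
rewrite <- (recip_recip f z); apply recip_zero, E.
Qed.

Lemma sphere_holo_recip (f : Cx -> Chat) : sphere_holo f -> sphere_holo (recip f).
Proof.
intros H z; destruct (H z) as [A|A]; [right|now left].
apply sdiff_ext with f; [intros y; symmetry; apply recip_recip | exact A].
Qed.

(** The difference quotient is filled in with [d] at [z]. The equation [phi z = d] is recorded,
    although [sdiff] forgets it, because the bound on [f' / f] concerns the given derivative. *)
Lemma has_cderiv_caratheodory (f : Cx -> Chat) (z d : C) : has_cderiv f z d ->
  locally (T := C_UniformSpace) z (fun y => f y <> None) /\
  exists phi : C -> C, ctsC (U := C_UniformSpace) phi z /\ phi z = d /\
    forall y : C, val (f y) = (val (f z) + phi y * (y - z))%C.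
Proof.
intros [w0 [E0 H]]; split.
- destruct (H 1 Rlt_0_1) as [r [Hr K]]; apply locally_Cmod; exists r; split; [exact Hr|].
  intros y Hy; destruct (classic (y = z)) as [->|N]; [rewrite E0; discriminate|].
  destruct (K y) as [w [E _]]; [|rewrite E; discriminate].
  rewrite Cnorm_Cmod; split; [|exact Hy].
  apply Cmod_gt_0; intros Q; apply N, Cminus_eq_0, Q.
- exists (fun y => if excluded_middle_informative (y = z) then d
    else ((val (f y) - val (f z)) / (y - z))%C).
  assert (NZ : forall y, y <> z -> (y - z)%C <> RtoC 0)
    by (intros y N Q; apply N, Cminus_eq_0, Q).
  split; [|split].
  + apply ctsC_eps; intros e He; destruct (H (e / 2)) as [r [Hr K]]; [lra|].
    apply locally_Cmod; exists r; split; [exact Hr|]; intros y Hy.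
    destruct (excluded_middle_informative (z = z)) as [_|Q]; [|contradiction].
    destruct (excluded_middle_informative (y = z)) as [_|N].
    { replace (d - d)%C with (RtoC 0) by ring; rewrite Cmod_0; exact He. }
    assert (P : 0 < Cmod (y - z)) by (apply Cmod_gt_0, NZ, N).
    destruct (K y) as [w [E B]]; [rewrite Cnorm_Cmod; split; assumption|].
    rewrite !Cnorm_Cmod in B; rewrite E, E0; simpl val.
    replace ((w - w0) / (y - z) - d)%C with ((w - w0 - d * (y - z)) / (y - z))%C
      by (field; apply NZ, N).
    rewrite Cmod_div by (apply NZ, N).
    apply Rmult_lt_reg_r with (Cmod (y - z)); [exact P|].
    unfold Rdiv; rewrite Rmult_assoc, Rinv_l, Rmult_1_r by lra.
    eapply Rle_lt_trans; [exact B|].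
    change (Csub y z) with (y - z)%C; nra.
  + destruct (excluded_middle_informative (z = z)) as [_|Q]; [reflexivity|contradiction].
  + intros y; cbv beta; destruct (excluded_middle_informative (y = z)) as [->|N].
    * ring.
    * field; apply NZ, N.
Qed.

Lemma has_cderiv_sdiff (f : Cx -> Chat) (z d : C) : has_cderiv f z d -> sdiff f z.
Proof.
intros H; destruct (has_cderiv_caratheodory f z d H) as [A [phi [B [_ D]]]].
split; [exact A | exists phi; split; assumption].
Qed.

Lemma meromorphic_sphere_holo (f : Cx -> Chat) : meromorphic f -> sphere_holo f.
Proof.
intros H z; destruct (H z) as [[d A]|[_ [[d A] _]]]; [left|right];
  eapply has_cderiv_sdiff, A.
Qed.

Lemma sdiff_translate (f : Cx -> Chat) (h z : C) :
  sdiff f (z + h)%C -> sdiff (translate f h) z.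
Proof.
intros [A B]; split.
- apply locally_Cmod in A; destruct A as [r [Hr A]]; apply locally_Cmod.
  exists r; split; [exact Hr|]; intros y Hy; apply (A (y + h)%C).
  replace (y + h - (z + h))%C with (y - z)%C by ring; exact Hy.
- apply Cdif_ext with (fun y => val (f (h + y)%C)).
  + intros y; unfold translate; change (Cadd y h) with (y + h)%C.
    now rewrite Cplus_comm.
  + apply (Cdif_shift (fun y => val (f y))); rewrite Cplus_comm; exact B.
Qed.

Lemma sphere_holo_translate (f : Cx -> Chat) (h : Cx) :
  sphere_holo f -> sphere_holo (translate f h).
Proof.
intros H z; destruct (H (z + h)%C) as [A|A]; [left|right].
- apply sdiff_translate, A.
- apply (sdiff_translate (recip f)), A.
Qed.

Lemma sdiff_rhoS_continuous (f : Cx -> Chat) (z : C) (e : R) : sdiff f z -> 0 < e ->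
  locally (T := C_UniformSpace) z (fun y => rhoS (f y) (f z) < e).
Proof.
intros [A B] He.
assert (Q := proj1 (ctsC_eps _ z) (Cdif_ctsC _ _ B) (e / 2) ltac:(lra)).
assert (K := locally_singleton _ _ A); cbv beta in K.
apply filter_imp with (2 := filter_and _ _ A Q); intros y [F1 F2].
destruct (f y) as [w|]; [|now elim F1]; destruct (f z) as [w0|]; [|now elim K].
eapply Rle_lt_trans; [apply rhoS_lipschitz|]; simpl in F2; lra.
Qed.

(** Continuity at a pole is continuity of [recip f] there, transported by the isometry
    [rhoS_recip]. *)
Lemma sphere_holo_continuous (f : Cx -> Chat) (z : C) (e : R) : sphere_holo f -> 0 < e ->
  exists d, 0 < d /\ forall y : C, Cmod (y - z) < d -> rhoS (f y) (f z) < e.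
Proof.
intros H He; apply locally_Cmod; destruct (H z) as [A|A].
- apply sdiff_rhoS_continuous; assumption.
- apply filter_imp with (2 := sdiff_rhoS_continuous _ _ e A He).
  intros y; now rewrite rhoS_recip.
Qed.

(** * Limits of uniformly Cauchy sequences of complex functions *)

Lemma complex_complete (s : nat -> C) :
  (forall e, 0 < e -> exists N, forall m n, (N <= m)%nat -> (N <= n)%nat ->
     Cmod (s m - s n) < e) ->
  exists l : C, forall e, 0 < e -> exists N, forall n, (N <= n)%nat -> Cmod (s n - l) < e.
Proof.
intros H.
assert (C1 : Cauchy_crit (fun n => fst (s n))).
{ intros e He; destruct (H e He) as [N HN]; exists N; intros n m Hn Hm; unfold Rdist.
  eapply Rle_lt_trans; [|apply (HN n m); assumption].
  apply (re_le_Cmod (s n - s m)). }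
assert (C2 : Cauchy_crit (fun n => snd (s n))).
{ intros e He; destruct (H e He) as [N HN]; exists N; intros n m Hn Hm; unfold Rdist.
  eapply Rle_lt_trans; [|apply (HN n m); assumption].
  eapply Rle_trans; [|apply Rmax_Cmod]. apply (Rmax_r _ (Rabs (snd (s n - s m)%C))). }
destruct (Rcomplete.R_complete _ C1) as [a Ha]; destruct (Rcomplete.R_complete _ C2) as [b Hb].
exists (a, b); intros e He.
destruct (Ha (e / 2)) as [N1 H1]; [lra|]; destruct (Hb (e / 2)) as [N2 H2]; [lra|].
exists (Nat.max N1 N2); intros n Hn.
specialize (H1 n ltac:(lia)); specialize (H2 n ltac:(lia)); unfold Rdist in *.
eapply Rle_lt_trans; [apply Cmod_2Rmax|]; simpl.
assert (S2 : sqrt 2 < 2).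
{ rewrite <- (sqrt_pow2 2) at 2 by lra; apply sqrt_lt_1_alt; lra. }
assert (M : Rmax (Rabs (fst (s n) + - a)) (Rabs (snd (s n) + - b)) < e / 2)
  by (apply Rmax_lub_lt; assumption).
assert (M0 : 0 <= Rmax (Rabs (fst (s n) + - a)) (Rabs (snd (s n) + - b))).
{ eapply Rle_trans; [apply Rabs_pos | apply Rmax_l]. }
assert (S0 := sqrt_pos 2); nra.
Qed.

Lemma uniform_cauchy_limit (rho : R) (v : nat -> C -> C) :
  (forall e, 0 < e -> exists N, forall m n, (N <= m)%nat -> (N <= n)%nat ->
     forall z, Cmod z <= rho -> Cmod (v m z - v n z) < e) ->
  exists h : C -> C, forall e, 0 < e -> exists N, forall n, (N <= n)%nat ->
     forall z, Cmod z <= rho -> Cmod (v n z - h z) <= e.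
Proof.
intros H.
assert (P : forall z, exists l : C, Cmod z <= rho ->
  forall e, 0 < e -> exists N, forall n, (N <= n)%nat -> Cmod (v n z - l) < e).
{ intros z; destruct (Rle_lt_dec (Cmod z) rho) as [L|L].
  - destruct (complex_complete (fun n => v n z)) as [l Hl]; [|now exists l].
    intros e He; destruct (H e He) as [N HN]; exists N; auto.
  - exists (RtoC 0); intros; lra. }
exists (fun z => proj1_sig (constructive_indefinite_description _ (P z))).
intros e He; destruct (H (e / 2)) as [N HN]; [lra|]; exists N; intros n Hn z Hz.
destruct (constructive_indefinite_description _ (P z)) as [l Hl]; simpl.
destruct (Hl Hz (e / 2)) as [N' HN']; [lra|].
assert (A1 := HN n (Nat.max N N') Hn ltac:(lia) z Hz).
assert (A2 := HN' (Nat.max N N') ltac:(lia)).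
replace (v n z - l)%C with ((v n z - v (Nat.max N N') z) + (v (Nat.max N N') z - l))%C by ring.
eapply Rle_trans; [apply Cmod_triangle | lra].
Qed.

(** * The zero set of the limit of a locally uniformly Cauchy sequence *)

Definition tends0 (F : nat -> Cx -> Chat) (z : Cx) : Prop :=
  forall e, 0 < e -> exists N, forall n, (N <= n)%nat -> rhoS (F n z) (Some C0) < e.

Section Propagation.

Variable F : nat -> Cx -> Chat.
Hypothesis Fholo : forall n, sphere_holo (F n).
Hypothesis Fcauchy : loc_unif_cauchy F.

(** A substitute for equicontinuity at [p]: continuity is used for the single map [F N], and all
    later maps are close to it on the unit disc around [p]. *)
Lemma near_point_cauchy (p : C) (e : R) : 0 < e -> exists N d, 0 < d /\
  (forall m n, (N <= m)%nat -> (N <= n)%nat -> forall z : C, Cmod (z - p) < 1 ->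
     rhoS (F m z) (F n z) < e) /\
  (forall z : C, Cmod (z - p) < d -> rhoS (F N z) (F N p) < e).
Proof.
intros He; destruct (Fcauchy (Cmod p + 1) e He) as [N HN].
destruct (sphere_holo_continuous (F N) p e (Fholo N) He) as [d [Hd K]].
exists N, d; split; [exact Hd|]; split; [|exact K].
intros m n Hm Hn z Hz; apply HN; try assumption.
rewrite Cnorm_Cmod; generalize (Cmod_le_dist z p); lra.
Qed.

Lemma tends0_closed (p : C) :
  (forall r, 0 < r -> exists q : C, Cmod (q - p) < r /\ tends0 F q) -> tends0 F p.
Proof.
intros H e He.
(* Four distances are chained: from [F n p] to [F N p], to [F N q], to a late term at [q], to
   [0]. *)
destruct (near_point_cauchy p (e / 4)) as [N [d [Hd [HN K]]]]; [lra|].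
destruct (H (Rmin d 1)) as [q [Hq T]]; [apply Rmin_glb_lt; lra|].
assert (Hq1 := Rlt_le_trans _ _ _ Hq (Rmin_l d 1)).
assert (Hq2 := Rlt_le_trans _ _ _ Hq (Rmin_r d 1)).
destruct (T (e / 4)) as [N' HN']; [lra|].
exists N; intros n Hn.
assert (Pp : Cmod (p - p) < 1) by (replace (p - p)%C with (RtoC 0) by ring; rewrite Cmod_0; lra).
assert (A1 := HN n N Hn (le_n N) p Pp).
assert (A2 := K q Hq1); rewrite rhoS_sym in A2.
assert (A3 := HN N (Nat.max N N') (le_n N) ltac:(lia) q Hq2).
assert (A4 := HN' (Nat.max N N') ltac:(lia)).
assert (T1 := rhoS_triangle (F n p) (F N p) (Some C0)).
assert (T2 := rhoS_triangle (F N p) (F N q) (Some C0)).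
assert (T3 := rhoS_triangle (F N q) (F (Nat.max N N') q) (Some C0)).
lra.
Qed.

(** Near a zero of the limit all late terms take values in the unit disc, so the chordal Cauchy
    condition becomes a Euclidean one and completeness of [C] applies. The bound [2] on [h] is [1]
    for the terms plus an error of [1]. *)
Lemma local_limit (p : C) (rmax : R) : 0 < rmax -> tends0 F p ->
  exists rho N (h : C -> C), 0 < rho <= rmax /\
    (forall n z, Cmod z <= rho -> F (n + N)%nat (p + z)%C <> None) /\
    (forall n z, Cmod z <= rho -> Cdif (fun y => val (F (n + N)%nat (p + y)%C)) z) /\
    (forall e, 0 < e -> exists N', forall n, (N' <= n)%nat -> forall z, Cmod z <= rho ->
       Cmod (val (F (n + N)%nat (p + z)%C) - h z) <= e) /\
    (forall z, Cmod z <= rho -> Cmod (h z) <= 2) /\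
    (forall z, Cmod z <= rho -> h z = RtoC 0 <-> tends0 F (p + z)%C).
Proof.
intros Hrm T.
(* Four distances below [/ 4] add up to less than [1], the threshold of [near_zero_finite]. *)
destruct (near_point_cauchy p (/ 4)) as [N0 [d [Hd [HN K]]]]; [lra|].
destruct (T (/ 4)) as [N1 HN1]; [lra|].
set (N := Nat.max N0 N1).
set (rho := Rmin (Rmin (d / 2) (/ 2)) rmax).
assert (R0 : 0 < rho) by (unfold rho; repeat apply Rmin_glb_lt; lra).
assert (R1 : rho <= d / 2) by (unfold rho; eapply Rle_trans; [apply Rmin_l | apply Rmin_l]).
assert (R2 : rho <= / 2) by (unfold rho; eapply Rle_trans; [apply Rmin_l | apply Rmin_r]).
assert (R3 : rho <= rmax) by (unfold rho; apply Rmin_r).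
assert (Shift : forall z, Cmod (p + z - p) = Cmod z) by (intros z; f_equal; ring).
assert (Small : forall n z, Cmod z <= rho ->
  exists w : C, F (n + N)%nat (p + z)%C = Some w /\ Cmod w <= 1).
{ intros n z Hz; apply near_zero_finite.
  assert (Pp : Cmod (p - p) < 1)
    by (replace (p - p)%C with (RtoC 0) by ring; rewrite Cmod_0; lra).
  assert (A1 := HN (n + N)%nat N0 ltac:(lia) (le_n _) (p + z)%C ltac:(rewrite Shift; lra)).
  assert (A2 := K (p + z)%C ltac:(rewrite Shift; lra)).
  assert (A3 := HN N0 N (le_n _) ltac:(lia) p Pp).
  assert (A4 := HN1 N ltac:(lia)).
  assert (T1 := rhoS_triangle (F (n + N)%nat (p + z)%C) (F N0 (p + z)%C) (Some C0)).
  assert (T2 := rhoS_triangle (F N0 (p + z)%C) (F N0 p) (Some C0)).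
  assert (T3 := rhoS_triangle (F N0 p) (F N p) (Some C0)).
  lra. }
set (v := fun n z => val (F (n + N)%nat (p + z)%C)).
assert (Vb : forall n z, Cmod z <= rho -> Cmod (v n z) <= 1).
{ intros n z Hz; destruct (Small n z Hz) as [w [E B]]; unfold v; now rewrite E. }
assert (Vd : forall m n z, Cmod z <= rho ->
  Cmod (v m z - v n z) <= rhoS (F (m + N)%nat (p + z)%C) (F (n + N)%nat (p + z)%C)).
{ intros m n z Hz; unfold v; destruct (Small m z Hz) as [w [E B]].
  destruct (Small n z Hz) as [w' [E' B']]; rewrite E, E'; apply dist_le_rhoS; assumption. }
destruct (uniform_cauchy_limit rho v) as [h Hh].
{ intros e He; destruct (near_point_cauchy p e He) as [N2 [_ [_ [HN2 _]]]].
  exists N2; intros m n Hm Hn z Hz; eapply Rle_lt_trans; [apply Vd, Hz|].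
  apply HN2; try lia; rewrite Shift; lra. }
exists rho, N, h; split; [lra|]; split; [|split; [|split; [|split]]].
- intros n z Hz; destruct (Small n z Hz) as [w [E _]]; rewrite E; discriminate.
- intros n z Hz; apply (Cdif_shift (fun y => val (F (n + N)%nat y))).
  apply sphere_holo_finite; [apply Fholo|].
  destruct (Small n z Hz) as [w [E _]]; rewrite E; discriminate.
- exact Hh.
- intros z Hz; destruct (Hh 1 Rlt_0_1) as [n Hn].
  assert (A1 := Hn n (le_n n) z Hz); assert (A2 := Vb n z Hz).
  assert (A3 := Cmod_le_dist (h z) (v n z)); rewrite Cmod_sym in A1; lra.
- intros z Hz; split.
  + intros E e He; destruct (Hh (e / 4)) as [N2 HN2]; [lra|].
    exists (N2 + N)%nat; intros n Hn.
    specialize (HN2 (n - N)%nat ltac:(lia) z Hz); rewrite E in HN2.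
    destruct (Small (n - N)%nat z Hz) as [w [Ew _]]; unfold v in HN2.
    rewrite Ew in HN2; simpl val in HN2.
    replace (n - N + N)%nat with n in Ew by lia; rewrite Ew.
    eapply Rle_lt_trans; [apply rhoS_lipschitz|].
    change C0 with (RtoC 0); lra.
  + intros T0; apply Cmod_eq_0, Rle_antisym; [|apply Cmod_ge_0].
    apply le_epsilon; intros e He; rewrite Rplus_0_l.
    destruct (Hh (e / 2)) as [N2 HN2]; [lra|]; destruct (T0 (e / 2)) as [N3 HN3]; [lra|].
    specialize (HN2 (Nat.max N2 N3) ltac:(lia) z Hz).
    specialize (HN3 (Nat.max N2 N3 + N)%nat ltac:(lia)).
    destruct (Small (Nat.max N2 N3) z Hz) as [w [Ew B]]; unfold v in HN2.
    rewrite Ew in HN2, HN3; simpl val in HN2.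
    assert (A1 := dist_le_rhoS w (RtoC 0) B ltac:(rewrite Cmod_0; lra)).
    replace (w - 0)%C with w in A1 by ring.
    change (Cmod w <= rhoS (Some w) (Some C0)) in A1.
    assert (A3 := Cmod_le_dist (h z) w); rewrite Cmod_sym in HN2; lra.
Qed.

Definition tends0_near (p : C) : Prop :=
  exists r, 0 < r /\ forall y : C, Cmod (y - p) < r -> tends0 F y.

Lemma tends0_near_of_zero_free (del : R) : 0 < del ->
  (forall n (z : C), Cmod z < del -> F n z <> Some C0) -> tends0 F C0 -> tends0_near C0.
Proof.
intros Hdel NZ T.
(* With [del / 2] the closed disc on which Hurwitz's theorem is applied lies in the open disc free
   of zeros. *)
destruct (local_limit C0 (del / 2)) as [rho [N [h [Hrho [Fin [Dif [Lim [Bd Iff]]]]]]]];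
  [lra | exact T |].
assert (Add0 : forall z : C, (C0 + z)%C = z) by (intros z; change C0 with (RtoC 0); ring).
exists rho; split; [lra|]; intros y Hy.
replace (y - C0)%C with y in Hy by (change C0 with (RtoC 0); ring).
rewrite <- (Add0 y); apply Iff; [lra|].
apply (hurwitz rho 2 (fun n z => val (F (n + N)%nat (C0 + z)%C))); try assumption; try lra.
- intros n z Hz E; assert (K := Fin n z Hz); rewrite Add0 in *.
  apply (NZ (n + N)%nat z); [lra|].
  destruct (F (n + N)%nat z) as [w|]; [simpl in E; now rewrite E | now elim K].
- apply Iff; [rewrite Cmod_0; lra|]; rewrite Add0; exact T.
Qed.

Lemma tends0_near_of_accumulation (p : C) : tends0 F p ->
  (forall r, 0 < r -> exists q : C, 0 < Cmod (q - p) < r /\ tends0 F q) -> tends0_near p.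
Proof.
intros T Acc.
destruct (local_limit p 1 Rlt_0_1 T) as [rho [N [h [Hrho [Fin [Dif [Lim [Bd Iff]]]]]]]].
assert (CR : cauchy_rep rho h).
{ apply cauchy_rep_limit with (fun n z => val (F (n + N)%nat (p + z)%C)); try lra; auto.
  intros n; apply cauchy_formula; [lra | apply Dif]. }
destruct (zero_or_power_lower_bound rho 2 h ltac:(lra) CR Bd)
  as [Z|[k [c [r [Hc [Hr L]]]]]].
- exists rho; split; [lra|]; intros y Hy.
  replace y with (p + (y - p))%C by ring; apply Iff; [lra|]; apply Z, Hy.
- exfalso; destruct (Acc r) as [q [Hq Tq]]; [lra|].
  assert (Lq := L (q - p)%C ltac:(lra)).
  assert (Zq : h (q - p)%C = RtoC 0).
  { apply Iff; [lra|]; replace (p + (q - p))%C with q by ring; exact Tq. }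
  rewrite Zq, Cmod_0 in Lq.
  assert (0 < c * Cmod (q - p) ^ k) by (apply Rmult_lt_0_compat; [exact Hc | apply pow_lt; lra]).
  lra.
Qed.

(** Continuity method on the segment from [0] to [z]: let [T] be the supremum of the parameters up
    to which the limit vanishes near every point. The point at [T] is an accumulation point of
    zeros, hence the limit vanishes near it too, and if [T < 1] this neighbourhood carries the
    property past [T]. *)
Lemma tends0_near_everywhere : tends0_near C0 -> forall z, tends0_near z.
Proof.
intros H0 z.
destruct (classic (z = RtoC 0)) as [->|Nz]; [exact H0|].
assert (Pz : 0 < Cmod z) by (apply Cmod_gt_0, Nz).
assert (Seg : forall s t, Cmod (RtoC s * z - RtoC t * z) = Rabs (s - t) * Cmod z).
{ intros s t; replace (RtoC s * z - RtoC t * z)%C with (RtoC (s - t)%R * z)%C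
    by (rewrite RtoC_minus; ring).
  now rewrite Cmod_mult, Cmod_R. }
assert (Start : tends0_near (RtoC 0 * z)%C) by (rewrite Cmult_0_l; exact H0).
destruct (completeness (fun t => 0 <= t <= 1 /\
  forall s, 0 <= s <= t -> tends0_near (RtoC s * z)%C)) as [T [Up Least]].
- exists 1; intros t [Ht _]; lra.
- exists 0; split; [lra|]; intros s Hs; replace s with 0 by lra; exact Start.
- assert (T0 : 0 <= T).
  { apply Up; split; [lra|]; intros s Hs; replace s with 0 by lra; exact Start. }
  assert (T1 : T <= 1) by (apply Least; intros t [Ht _]; lra).
  assert (Below : forall s, 0 <= s < T -> tends0_near (RtoC s * z)%C).
  { intros s Hs; apply NNPP; intros Q.
    assert (T <= s); [|lra]; apply Least; intros t [Ht A].
    destruct (Rle_lt_dec t s) as [L|L]; [exact L|exfalso; apply Q, A; lra]. }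
  assert (AtT : tends0_near (RtoC T * z)%C).
  { destruct (Req_dec T 0) as [->|NT]; [exact Start|].
    assert (Acc : forall r, 0 < r -> exists q : C,
      0 < Cmod (q - RtoC T * z) < r /\ tends0 F q).
    { intros r Hr.
      set (x := Rmin (T / 2) (r / (2 * Cmod z))).
      assert (X0 : 0 < x) by (apply Rmin_glb_lt; [lra | apply Rdiv_lt_0_compat; lra]).
      assert (X1 : x <= T / 2) by apply Rmin_l.
      assert (X2 : x * Cmod z <= r / 2).
      { replace (r / 2) with (r / (2 * Cmod z) * Cmod z) by (field; lra).
        apply Rmult_le_compat_r; [lra | apply Rmin_r]. }
      exists (RtoC (T - x)%R * z)%C; rewrite Seg.
      replace (T - x - T) with (- x) by ring; rewrite Rabs_Ropp, Rabs_pos_eq by lra.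
      split; [split; [nra | lra]|].
      destruct (Below (T - x)) as [r' [Hr' K]]; [lra|]; apply K.
      replace (RtoC (T - x)%R * z - RtoC (T - x)%R * z)%C with (RtoC 0) by ring.
      rewrite Cmod_0; exact Hr'. }
    apply tends0_near_of_accumulation; [|exact Acc].
    apply tends0_closed; intros r Hr; destruct (Acc r Hr) as [q [Hq Tq]]; exists q; split;
      [lra | exact Tq]. }
  destruct (Req_dec T 1) as [E|NE].
  { rewrite E, Cmult_1_l in AtT; exact AtT. }
  exfalso; destruct AtT as [r [Hr K]].
  (* Points with parameter up to [T + x] are within [r / 2] of the point at [T], so their discs of
     radius [r / 2] lie in its disc of radius [r]. *)
  set (x := Rmin (1 - T) (r / (2 * Cmod z))).
  assert (X0 : 0 < x) by (apply Rmin_glb_lt; [lra | apply Rdiv_lt_0_compat; lra]).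
  assert (X1 : x <= 1 - T) by apply Rmin_l.
  assert (X2 : x * Cmod z <= r / 2).
  { replace (r / 2) with (r / (2 * Cmod z) * Cmod z) by (field; lra).
    apply Rmult_le_compat_r; [lra | apply Rmin_r]. }
  assert (T + x <= T); [|lra]; apply Up; split; [lra|]; intros s Hs.
  destruct (Rlt_le_dec s T) as [L|L]; [apply Below; lra|].
  assert (D : Cmod (RtoC s * z - RtoC T * z) <= r / 2).
  { rewrite Seg, Rabs_pos_eq by lra.
    eapply Rle_trans; [apply Rmult_le_compat_r; [lra|] | exact X2]; lra. }
  exists (r / 2); split; [lra|]; intros y Hy; apply K.
  replace (y - RtoC T * z)%C with ((y - RtoC s * z) + (RtoC s * z - RtoC T * z))%C by ring.
  eapply Rle_lt_trans; [apply Cmod_triangle | lra].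
Qed.

(** In a uniform Cauchy estimate one index may be sent to infinity, at a rate depending on the
    point. *)
Lemma tends0_everywhere_uniform : (forall z, tends0 F z) ->
  loc_unif_conv F (fun _ => Some C0).
Proof.
intros H Rad e He; destruct (Fcauchy Rad (e / 2)) as [N HN]; [lra|].
exists N; intros n Hn z Hz; destruct (H z (e / 2)) as [N' HN']; [lra|].
assert (A1 := HN n (Nat.max N N') Hn ltac:(lia) z Hz).
assert (A2 := HN' (Nat.max N N') ltac:(lia)).
assert (T := rhoS_triangle (F n z) (F (Nat.max N N') z) (Some C0)); lra.
Qed.

Lemma zero_free_limit_zero (del : R) : 0 < del ->
  (forall n (z : C), Cmod z < del -> F n z <> Some C0) -> tends0 F C0 ->
  loc_unif_conv F (fun _ => Some C0).
Proof.
intros Hdel NZ T; apply tends0_everywhere_uniform; intros z.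
destruct (tends0_near_everywhere (tends0_near_of_zero_free del Hdel NZ T) z) as [r [Hr K]].
apply (K z); change (Csub z z) with (z - z)%C.
replace ((z : C) - (z : C))%C with (RtoC 0) by ring; rewrite Cmod_0; exact Hr.
Qed.

End Propagation.

(** * Uniform bounds away from zeros and poles *)

Lemma strictly_increasing_ge (phi : nat -> nat) :
  strictly_increasing phi -> forall n, (n <= phi n)%nat.
Proof. intros H n; induction n as [|n IH]; [lia|]; specialize (H n); lia. Qed.

(** The hypotheses are stated for [sphere_holo] maps and exclude only the limit [0], so that the
    lemma can be used for [recip f], where this excludes the limit infinity of the translates of
    [f]. *)
Lemma lower_bound_away_from_zeros (f : Cx -> Chat) (del : R) :
  sphere_holo f ->
  (forall h : nat -> Cx, exists phi, strictly_increasing phi /\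
     loc_unif_cauchy (fun n => translate f (h (phi n)))) ->
  (forall (h : nat -> Cx) (phi : nat -> nat), strictly_increasing phi ->
     ~ loc_unif_conv (fun n => translate f (h (phi n))) (fun _ => Some C0)) ->
  0 < del ->
  exists c, 0 < c /\ forall z w, away_from_zeros f del z -> f z = Some w -> c <= Cnorm w.
Proof.
intros Hol Nor NC Hdel; apply NNPP; intros Neg.
assert (Bad : forall n, exists z, away_from_zeros f del z /\
  exists w, f z = Some w /\ Cnorm w < / (INR n + 1)).
{ intros n; apply NNPP; intros Q; apply Neg; exists (/ (INR n + 1)); split.
  - apply Rinv_0_lt_compat; generalize (pos_INR n); lra.
  - intros z w Hz E; apply Rnot_lt_le; intros L; apply Q; exists z; split; [exact Hz|].
    exists w; split; assumption. }
pose (h := fun n => proj1_sig (constructive_indefinite_description _ (Bad n))).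
assert (Hh : forall n, away_from_zeros f del (h n) /\
  exists w, f (h n) = Some w /\ Cnorm w < / (INR n + 1)).
{ intros n; exact (proj2_sig (constructive_indefinite_description _ (Bad n))). }
destruct (Nor h) as [phi [Inc Cau]].
apply (NC h phi Inc); apply zero_free_limit_zero with del; auto.
- intros n; apply sphere_holo_translate, Hol.
- intros n z Hz E; unfold translate in E.
  (* A zero of the translate at [z] is a zero of [f] at distance [Cmod z < del] from [h (phi n)]. *)
  assert (K := proj1 (Hh (phi n)) _ E); rewrite Cnorm_Cmod in K.
  change (Csub (h (phi n)) (Cadd z (h (phi n))))
    with ((h (phi n) : C) - (z + (h (phi n) : C)))%C in K.
  replace ((h (phi n) : C) - (z + (h (phi n) : C)))%C with (- z)%C in K by ring.
  rewrite Cmod_opp in K; lra.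
- intros e He.
  destruct (archimed_cor1 (e / 2)) as [N [HN HN0]]; [lra|].
  exists N; intros n Hn; unfold translate.
  replace (Cadd C0 (h (phi n))) with (h (phi n))
    by (unfold Cadd, C0; apply injective_projections; simpl; ring).
  destruct (proj2 (Hh (phi n))) as [w [E B]]; rewrite E.
  eapply Rle_lt_trans; [apply rhoS_lipschitz|].
  replace ((w : C) - C0)%C with (w : C) by (symmetry; exact (Cminus_0_r w)).
  rewrite Cnorm_Cmod in B.
  assert (I1 := strictly_increasing_ge phi Inc n).
  assert (I2 : INR N <= INR (phi n)) by (apply le_INR; lia).
  assert (I3 : 0 < INR N) by (apply lt_0_INR; lia).
  assert (I4 : / (INR (phi n) + 1) <= / INR N) by (apply Rinv_le_contravar; lra).
  lra.
Qed.

Lemma away_from_zeros_recip (f : Cx -> Chat) (del : R) (z : Cx) :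
  away_from_poles f del z -> away_from_zeros (recip f) del z.
Proof.
intros H a E; apply H; rewrite <- (recip_recip f a); apply recip_zero, E.
Qed.

Theorem mainTheorem13 (f : Cx -> Chat) (del : R) :
  in_N1 f -> 0 < del ->
  exists Cd Cd' : R, 0 < Cd /\ 0 <= Cd' /\
    (forall z w, away_from_poles f del z -> f z = Some w -> Cnorm w <= Cd) /\
    (forall z w, away_from_zeros f del z -> f z = Some w -> / Cd <= Cnorm w) /\
    (forall z w d, away_from_zeros f del z -> away_from_poles f del z ->
       f z = Some w -> has_cderiv f z d -> Cnorm (Cdiv d w) <= Cd').
Proof.
intros [[Mer Nor] NC] Hdel.
assert (Hol := meromorphic_sphere_holo f Mer).
assert (Low : forall r, 0 < r -> exists c, 0 < c /\
  forall z w, away_from_zeros f r z -> f z = Some w -> c <= Cnorm w).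
{ intros r Hr; apply lower_bound_away_from_zeros; auto.
  intros h phi Inc Conv; apply (NC h phi _ Inc Conv); now exists (Some C0). }
assert (Upp : forall r, 0 < r -> exists B, 0 < B /\
  forall z w, away_from_poles f r z -> f z = Some w -> Cnorm w <= B).
{ intros r Hr.
  destruct (lower_bound_away_from_zeros (recip f) r) as [c [Hc K]]; auto.
  - apply sphere_holo_recip, Hol.
  - intros h; destruct (Nor h) as [phi [Inc Cau]]; exists phi; split; [exact Inc|].
    intros Rad e He; destruct (Cau Rad e He) as [N HN]; exists N; intros m n Hm Hn z Hz.
    unfold translate; rewrite rhoS_recip; apply (HN m n Hm Hn z Hz).
  - intros h phi Inc Conv; apply (NC h phi (fun _ => None) Inc); [|now exists None].
    intros Rad e He; destruct (Conv Rad e He) as [N HN]; exists N; intros n Hn z Hz.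
    specialize (HN n Hn z Hz); unfold translate in *.
    (* The constant [0] is the reciprocal of the constant infinity, so the isometry turns the limit
       [0] of [recip f] into the limit infinity of [f]. *)
    change (Some C0) with (recip (fun _ => None) z) in HN; rewrite rhoS_recip in HN; exact HN.
  - exists (/ c); split; [apply Rinv_0_lt_compat, Hc|]; intros z w Hz E.
    rewrite Cnorm_Cmod; destruct (classic ((w : C) = RtoC 0)) as [->|N].
    + rewrite Cmod_0; apply Rlt_le, Rinv_0_lt_compat, Hc.
    + assert (L := K z _ (away_from_zeros_recip f r z Hz) (recip_Some f z w E N)).
      rewrite Cnorm_Cmod, Cmod_inv in L by exact N.
      apply Rinv_le_contravar in L; [|exact Hc]; rewrite Rinv_inv in L; exact L. }
destruct (Low del Hdel) as [c [Hc HL]].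
destruct (Upp del Hdel) as [B [HB HU]].
(* Cauchy's estimate at [z] needs [f] bounded on a disc around [z]; points within [del / 2] of [z]
   still keep distance [del / 2] from the poles. *)
destruct (Upp (del / 2)) as [B2 [HB2 HU2]]; [lra|].
(* The maximum serves the upper and the lower bound at once; the second constant is Cauchy's
   estimate for [f'] on radius [del / 2] times the bound [/ c] for [1 / f]. *)
exists (Rmax B (/ c)), (2 * B2 / (del / 2) * / c).
assert (Ic : 0 < / c) by (apply Rinv_0_lt_compat, Hc).
split; [|split; [|split; [|split]]].
- eapply Rlt_le_trans; [exact HB | apply Rmax_l].
- apply Rmult_le_pos; [apply Rdiv_le_0_compat; lra | lra].
- intros z w Hz E; eapply Rle_trans; [apply (HU z w Hz E) | apply Rmax_l].
- intros z w Hz E; eapply Rle_trans; [|apply (HL z w Hz E)].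
  apply Rle_trans with (/ / c); [|right; apply Rinv_inv].
  apply Rinv_le_contravar; [exact Ic | apply Rmax_r].
- intros z w d Hz Hp E Hd.
  assert (Lw := HL z w Hz E); rewrite Cnorm_Cmod in *.
  assert (Nw : (w : C) <> RtoC 0) by (apply Cmod_gt_0; lra).
  unfold Cdiv; rewrite Cinv_Complex; change (Cmul d (/ (w : C))%C) with ((d : C) * / (w : C))%C.
  rewrite Cmod_mult, Cmod_inv by exact Nw.
  destruct (has_cderiv_caratheodory f z d Hd) as [_ [phi [Cphi [Ephi Kphi]]]].
  assert (Near : forall y : C, Cmod y <= del / 2 -> away_from_poles f (del / 2) ((z : C) + y)%C).
  { intros y Hy b Eb; specialize (Hp b Eb); rewrite Cnorm_Cmod in Hp |- *.
    change (Csub ((z : C) + y)%C b) with ((z : C) + y - (b : C))%C.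
    change (Csub z b) with ((z : C) - (b : C))%C in Hp.
    assert (T := Cmod_le_dist ((z : C) - (b : C)) ((z : C) + y - (b : C))).
    replace ((z : C) - (b : C) - ((z : C) + y - (b : C)))%C with (- y)%C in T by ring.
    rewrite Cmod_opp in T; lra. }
  assert (Fin : forall y : C, Cmod y <= del / 2 -> f ((z : C) + y)%C <> None).
  { intros y Hy Q; specialize (Near y Hy _ Q); rewrite Cnorm_Cmod in Near.
    change (Csub ((z : C) + y)%C ((z : C) + y)%C)
      with ((z : C) + y - ((z : C) + y))%C in Near.
    replace ((z : C) + y - ((z : C) + y))%C with (RtoC 0) in Near by ring.
    rewrite Cmod_0 in Near; lra. }
  assert (Est : Cmod (phi ((z : C) + RtoC 0)%C) <= 2 * B2 / (del / 2)).
  { apply (cauchy_estimate (del / 2) B2 (fun y => val (f ((z : C) + y)%C))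
      (fun y => phi ((z : C) + y)%C)); [lra| | | |].
    - intros y Hy; apply (Cdif_shift (fun y => val (f y))).
      apply sphere_holo_finite; [exact Hol | apply Fin, Hy].
    - intros y Hy; assert (Q := Fin y Hy); assert (U := fun w => HU2 _ w (Near y Hy)).
      destruct (f ((z : C) + y)%C) as [w'|]; [|now elim Q].
      simpl; rewrite <- Cnorm_Cmod; apply U; reflexivity.
    - apply (ctsC_comp phi (U := C_UniformSpace) (fun y => (z : C) + y)%C).
      + apply ctsC_plus; [apply ctsC_const | apply ctsC_id].
      + rewrite Cplus_0_r; exact Cphi.
    - intros y; rewrite Cplus_0_r, (Kphi ((z : C) + y)%C); f_equal; f_equal; ring. }
  rewrite Cplus_0_r, Ephi in Est.
  apply Rmult_le_compat; [apply Cmod_ge_0 | | exact Est |].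
  + apply Rlt_le, Rinv_0_lt_compat; lra.
  + apply Rinv_le_contravar; assumption.
Qed.
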